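(* Let $\alpha>1$ and $f\in\mathcal{M}_\alpha$. Then for every $s=\sigma+it$ with $0<\sigma<1$, $$\zeta^2(s)f^*(s)=\int_0^\infty x^{s-1}\Big[\sum_{n=1}^\infty d(n)f(nx)-\int_0^\infty f(xy)(\log y+2\gamma)\,dy\Big]dx .$$
   Context: For $\alpha>1$, $\mathcal{M}_\alpha$ denotes the class of functions $f:[0,\infty)\to\mathbb{C}$ with $f\in C^{2}[0,\infty)$ and $f^{(j)}(x)=O(x^{-\alpha-j})$ as $x\to\infty$ for $j=0,1,2$. The Mellin transform is $f^*(s)=\int_0^\infty f(x)x^{s-1}\,dx$. $d(n)$ is the number of divisors of $n$, $\gamma$ is Euler's constant, $\zeta$ is the Riemann zeta function. *)

(* Defs.v *)
From Stdlib Require Import Reals Lra Lia List Arith ClassicalEpsilon.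
Open Scope R_scope.

Definition Cplx : Type := (R * R)%type.
Definition Cre (z : Cplx) : R := fst z.
Definition Cim (z : Cplx) : R := snd z.
Definition mkC (a b : R) : Cplx := (a, b).
Definition RtoC (a : R) : Cplx := (a, 0).
Definition Cadd (z w : Cplx) : Cplx := (Cre z + Cre w, Cim z + Cim w).
Definition Csub (z w : Cplx) : Cplx := (Cre z - Cre w, Cim z - Cim w).
Definition Cmul (z w : Cplx) : Cplx :=
  (Cre z * Cre w - Cim z * Cim w, Cre z * Cim w + Cim z * Cre w).
Definition Cnorm (z : Cplx) : R := sqrt (Cre z ^ 2 + Cim z ^ 2).
Definition Cexp (z : Cplx) : Cplx := (exp (Cre z) * cos (Cim z), exp (Cre z) * sin (Cim z)).
Definition Cpow (x : R) (s : Cplx) : Cplx := Cexp (Cmul (RtoC (ln x)) s).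

Definition ndiv (n : nat) : nat :=
  length (filter (fun k => Nat.eqb (n mod k) 0) (seq 1 n)).

Definition euler_gamma : R :=
  epsilon (inhabits 0)
    (fun g => Un_cv (fun n => sum_f_R0 (fun k => / INR (S k)) n - ln (INR (S n))) g).

Definition has_sum_C (a : nat -> Cplx) (l : Cplx) : Prop :=
  infinite_sum (fun n => Cre (a n)) (Cre l) /\ infinite_sum (fun n => Cim (a n)) (Cim l).
Definition series_C (a : nat -> Cplx) : Cplx :=
  epsilon (inhabits (RtoC 0)) (fun l => has_sum_C a l).

(** * Riemann zeta for 0 < Re s (s <> 1), via the Dirichlet eta function:
      (1 - 2^{1-s}) zeta(s) = sum_{n>=1} (-1)^{n-1} n^{-s}. *)
Definition eta_term (s : Cplx) (n : nat) : Cplx :=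
  Cmul (RtoC ((-1) ^ n)) (Cpow (INR (S n)) (Csub (RtoC 0) s)).
Definition zeta (s : Cplx) : Cplx :=
  epsilon (inhabits (RtoC 0))
    (fun z => has_sum_C (eta_term s)
                (Cmul (Csub (RtoC 1) (Cpow 2 (Csub (RtoC 1) s))) z)).

Definition riemann_int (g : R -> R) (a b I : R) : Prop :=
  exists pr : Riemann_integrable g a b, RiemannInt pr = I.

Definition has_integral_0_inf (g : R -> R) (l : R) : Prop :=
  (forall a b, 0 < a -> a <= b -> exists I, riemann_int g a b I) /\
  (forall eps, 0 < eps -> exists d M, 0 < d /\ d <= M /\
     forall a b I, 0 < a -> a < d -> M < b -> riemann_int g a b I -> Rabs (I - l) < eps).

Definition has_integral_0_inf_C (g : R -> Cplx) (l : Cplx) : Prop :=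
  has_integral_0_inf (fun x => Cre (g x)) (Cre l) /\
  has_integral_0_inf (fun x => Cim (g x)) (Cim l).

Definition integral_0_inf_C (g : R -> Cplx) : Cplx :=
  epsilon (inhabits (RtoC 0)) (fun l => has_integral_0_inf_C g l).

Definition mellin (f : R -> Cplx) (s : Cplx) : Cplx :=
  integral_0_inf_C (fun x => Cmul (f x) (Cpow x (Csub s (RtoC 1)))).

Definition deriv_within_nonneg (g g' : R -> R) (x : R) : Prop :=
  forall eps, 0 < eps -> exists delta, 0 < delta /\
    forall h, h <> 0 -> 0 <= x + h -> Rabs h < delta ->
      Rabs ((g (x + h) - g x) / h - g' x) < eps.

Definition cont_within_nonneg (g : R -> R) (x : R) : Prop :=
  forall eps, 0 < eps -> exists delta, 0 < delta /\
    forall y, 0 <= y -> Rabs (y - x) < delta -> Rabs (g y - g x) < eps.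

Definition deriv_C_nonneg (g g' : R -> Cplx) : Prop :=
  forall x, 0 <= x ->
    deriv_within_nonneg (fun y => Cre (g y)) (fun y => Cre (g' y)) x /\
    deriv_within_nonneg (fun y => Cim (g y)) (fun y => Cim (g' y)) x.

Definition M_class (alpha : R) (f : R -> Cplx) : Prop :=
  exists f1 f2 : R -> Cplx,
    deriv_C_nonneg f f1 /\ deriv_C_nonneg f1 f2 /\
    (forall x, 0 <= x -> cont_within_nonneg (fun y => Cre (f2 y)) x /\
                         cont_within_nonneg (fun y => Cim (f2 y)) x) /\
    exists K X, 0 < X /\ forall x, X < x ->
      Cnorm (f x) <= K * Rpower x (- alpha) /\
      Cnorm (f1 x) <= K * Rpower x (- alpha - 1) /\
      Cnorm (f2 x) <= K * Rpower x (- alpha - 2).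

(* Main.v *)
From Stdlib Require Import Reals Lra Lia List Arith ClassicalEpsilon.
From Coquelicot Require Import Rcomplements Rbar Hierarchy Continuity Derive RInt
  RInt_analysis ElemFct AutoDerive Lim_seq.
Require Import Defs.
Open Scope R_scope.

(** The divisor sum comes from applying Muntz's formula twice.
    For [0 < Re s < 1] one has [zeta s = lim_N (sum_(n <= N) n^(-s) - int_0^N y^(-s) dy)], so the Mellin
    transform of [D_N g (x) = sum_(n <= N) g (n x) - int_0^N g (x y) dy] is [g^*(s)] times the [N]-th term of
    that sequence.  If [|g v - g w| <= C (w^(-p) - v^(-p))] for [w <= v], the sums telescope to
    [|D_N g x - D_M g x| <= C (M x)^(-p)]; using this with [p] slightly below and slightly above [Re s]
    lets [N] tend to infinity under the integral, and [lim D_N g] has Mellin transform [zeta s * g^*(s)].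
    For [f] in the class M_alpha, [x (D_N f)'(x) = D_N h (x)] with [h x = x f'(x)], so that [g = lim D_N f]
    again satisfies the hypotheses and the formula may be applied to it.  Finally
    [sum_(n <= N) g (n x) = sum_(k <= N) d(k) f (k x) - (I / x) H_N + o(1)] with [I = int f], and
    [int_0^T g = gamma I + int f ln - I ln T + o(1)], which identifies [lim D_N g] with the bracket in the
    theorem. *)

(** * Powers, limits and primitives on the half-line *)

(** All integrals are handled through primitives on the open half-line: an improper integral is the
    limit at infinity of the primitive that vanishes at 0. Explicit rates of convergence take the
    place of dominated convergence, and integration by parts that of Fubini's theorem. The two
    orders of smoothness are spent one per application of the formula: the first needs increments of
    [f], hence [f']; the second needs increments of the limit [g], and those of the approximants
    lead to increments of [x f'], hence to [f'']. Since [g] is known only as a limit, it is never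
    differentiated: the hypothesis is put on increments because a bound on increments passes to a
    pointwise limit. Exponents on both sides of [Re s] must be served by the same function and the
    same primitive, so the estimates are proved for every exponent in (0, 1) at once. The decay
    beyond order 1 is written [4 e] to be spent in parts: a logarithm costs [x^e], and [2 e] pays
    for completing the truncated rows of the hyperbola [i j <= N]. The two copies of [euler_gamma]
    arise separately, one from summing [I / (n x)], the other from the primitive of [g]. *)

Ltac R_eq := match goal with |- @eq _ ?a ?b => change (@eq R a b) end.

Lemma Rpower_pos (x r : R) : 0 < Rpower x r.
Proof. apply exp_pos. Qed.

Lemma is_derive_Rpower (r x : R) :
  0 < x -> is_derive (fun y => Rpower y r) x (r * Rpower x (r - 1)).
Proof.
intros Hx; apply is_derive_Reals, derivable_pt_lim_power; exact Hx.
Qed.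

Lemma is_derive_Rpower_div (r x : R) :
  r <> 0 -> 0 < x -> is_derive (fun y => Rpower y r / r) x (Rpower x (r - 1)).
Proof.
intros Hr Hx.
replace (Rpower x (r - 1)) with (/ r * (r * Rpower x (r - 1))) by (field; exact Hr).
apply (is_derive_ext (fun y => / r * Rpower y r)); [intros y; R_eq; unfold Rdiv; ring|].
apply is_derive_scal, is_derive_Rpower, Hx.
Qed.

Lemma Rpower_le_base (x y r : R) : 0 <= r -> 0 < x <= y -> Rpower x r <= Rpower y r.
Proof. intros; apply Rle_Rpower_l; lra. Qed.

Lemma Rpower_ge_base (x y r : R) : r <= 0 -> 0 < x <= y -> Rpower y r <= Rpower x r.
Proof.
intros Hr Hxy.
rewrite <- (Ropp_involutive r), (Rpower_Ropp x), (Rpower_Ropp y).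
apply Rinv_le_contravar; [apply Rpower_pos | apply Rpower_le_base; lra].
Qed.

Definition lim_zero (A : R -> R) (l : R) : Prop := filterlim A (at_right 0) (locally l).
Definition lim_infty (A : R -> R) (l : R) : Prop :=
  filterlim A (Rbar_locally p_infty) (locally l).

Lemma lim_zero_spec (A : R -> R) (l : R) :
  lim_zero A l <->
  forall eps, 0 < eps -> exists d, 0 < d /\ forall x, 0 < x < d -> Rabs (A x - l) < eps.
Proof.
split.
- intros H eps Heps.
  destruct (proj1 (filterlim_locally A l) H (mkposreal eps Heps)) as [d Hd].
  exists d; split; [apply cond_pos | intros x Hx].
  apply (Hd x); [|lra]. change (Rabs (x - 0) < d). rewrite Rabs_pos_eq; lra.
- intros H; apply filterlim_locally; intros eps.
  destruct (H eps (cond_pos eps)) as [d [Hd Hx]].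
  exists (mkposreal d Hd); intros x Hb Hx0; apply Hx; split; [exact Hx0|].
  change (Rabs (x - 0) < d) in Hb. rewrite Rabs_pos_eq in Hb; lra.
Qed.

Lemma lim_infty_spec (A : R -> R) (l : R) :
  lim_infty A l <->
  forall eps, 0 < eps -> exists M, 0 < M /\ forall x, M < x -> Rabs (A x - l) < eps.
Proof.
split.
- intros H eps Heps.
  destruct (proj1 (filterlim_locally A l) H (mkposreal eps Heps)) as [M HM].
  exists (Rmax 1 M); split; [pose proof (Rmax_l 1 M); lra | intros x Hx].
  apply (HM x). pose proof (Rmax_r 1 M); lra.
- intros H; apply filterlim_locally; intros eps.
  destruct (H eps (cond_pos eps)) as [M [HM Hx]].
  exists M; intros x Hb; apply Hx; exact Hb.
Qed.

Lemma Rpower_small (r K eps : R) : 0 < r -> 0 <= K -> 0 < eps ->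
  exists d, 0 < d /\ forall x, 0 < x < d -> K * Rpower x r < eps.
Proof.
intros Hr HK He.
exists (Rpower (eps / (K + 1)) (/ r)); split; [apply Rpower_pos|intros x Hx].
assert (Hq : 0 < eps / (K + 1)) by (apply Rdiv_lt_0_compat; lra).
assert (Rpower x r < eps / (K + 1)).
{ revert Hq Hx; generalize (eps / (K + 1)); intros q Hq Hx.
  rewrite <- (Rpower_1 q) by exact Hq.
  rewrite <- (Rinv_l r) by lra. rewrite <- Rpower_mult.
  apply Rlt_Rpower_l; [lra | exact Hx]. }
assert (eps = (K + 1) * (eps / (K + 1))) by (field; lra).
pose proof (Rpower_pos x r). nra.
Qed.

Lemma Rpower_inv_base (x r : R) : 0 < x -> Rpower (/ x) r = Rpower x (- r).
Proof. intros Hx; unfold Rpower; rewrite ln_Rinv by exact Hx; f_equal; ring. Qed.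

Lemma Rpower_large (r K eps : R) : 0 < r -> 0 <= K -> 0 < eps ->
  exists M, 0 < M /\ forall x, M < x -> K * Rpower x (- r) < eps.
Proof.
intros Hr HK He.
destruct (Rpower_small r K eps Hr HK He) as [d [Hd H]].
exists (/ d); split; [apply Rinv_0_lt_compat, Hd | intros x Hx].
assert (0 < / d) by (apply Rinv_0_lt_compat, Hd).
rewrite <- Rpower_inv_base by lra. apply H. split.
- apply Rinv_0_lt_compat; lra.
- rewrite <- (Rinv_inv d). apply Rinv_lt_contravar; [apply Rmult_lt_0_compat; lra | exact Hx].
Qed.

Lemma lim_zero_of_bound (A : R -> R) (l K r : R) : 0 < r ->
  (forall x, 0 < x -> Rabs (A x - l) <= K * Rpower x r) -> lim_zero A l.
Proof.
intros Hr H; apply lim_zero_spec; intros eps He.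
destruct (Rpower_small r (Rabs K) eps Hr (Rabs_pos K) He) as [d [Hd Hx]].
exists d; split; [exact Hd | intros x Hxd].
eapply Rle_lt_trans; [apply H; lra|].
eapply Rle_lt_trans; [|apply (Hx x Hxd)].
apply Rmult_le_compat_r; [left; apply Rpower_pos | apply Rle_abs].
Qed.

Lemma lim_infty_of_bound (A : R -> R) (l K r : R) : 0 < r ->
  (forall x, 0 < x -> Rabs (A x - l) <= K * Rpower x (- r)) -> lim_infty A l.
Proof.
intros Hr H; apply lim_infty_spec; intros eps He.
destruct (Rpower_large r (Rabs K) eps Hr (Rabs_pos K) He) as [d [Hd Hx]].
exists d; split; [exact Hd | intros x Hxd].
eapply Rle_lt_trans; [apply H; lra|].
eapply Rle_lt_trans; [|apply (Hx x Hxd)].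
apply Rmult_le_compat_r; [left; apply Rpower_pos | apply Rle_abs].
Qed.

Lemma is_lim_seq_of_bound (u : nat -> R) (l K r : R) : 0 < r ->
  (forall n, Rabs (u n - l) <= K * Rpower (INR (S n)) (- r)) -> is_lim_seq u l.
Proof.
intros Hr H; apply is_lim_seq_spec; intros eps.
destruct (Rpower_large r (Rabs K) eps Hr (Rabs_pos K) (cond_pos eps)) as [M [HM Hx]].
destruct (INR_unbounded M) as [N HN].
exists N; intros n Hn.
eapply Rle_lt_trans; [apply H|].
eapply Rle_lt_trans; [|apply (Hx (INR (S n)))].
- apply Rmult_le_compat_r; [left; apply Rpower_pos | apply Rle_abs].
- apply le_INR in Hn. rewrite S_INR; lra.
Qed.

Lemma is_lim_seq_Rabs_le (u : nat -> R) (l c B : R) :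
  is_lim_seq u l -> (forall n, Rabs (u n - c) <= B) -> Rabs (l - c) <= B.
Proof.
intros Hu H.
assert (H1 : is_lim_seq (fun n => Rabs (u n - c)) (Rabs (l - c))).
{ apply (is_lim_seq_abs (fun n => u n - c) (l - c)).
  apply is_lim_seq_minus'; [exact Hu | apply is_lim_seq_const]. }
exact (is_lim_seq_le _ (fun _ => B) (Rabs (l - c)) B H H1 (is_lim_seq_const B)).
Qed.

Lemma is_derive_mvt (A a : R -> R) (w v : R) : 0 < w < v ->
  (forall x, 0 < x -> is_derive A x (a x)) ->
  exists c, w <= c <= v /\ A v - A w = a c * (v - w).
Proof.
intros Hwv HA.
destruct (MVT_gen A w v a) as [c [Hc1 Hc2]].
- intros x; rewrite Rmin_left, Rmax_right by lra; intros; apply HA; lra.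
- intros x; rewrite Rmin_left, Rmax_right by lra; intros.
  apply derivable_continuous_pt; exists (a x); apply is_derive_Reals, HA; lra.
- rewrite Rmin_left, Rmax_right in Hc1 by lra. exists c; split; [lra | exact Hc2].
Qed.

(** Both [B - A] and [B + A] have a nonnegative derivative; the mean value theorem is applied to
    each. *)
Lemma derive_dominated (A a B b : R -> R) (w v : R) : 0 < w <= v ->
  (forall x, 0 < x -> is_derive A x (a x)) ->
  (forall x, 0 < x -> is_derive B x (b x)) ->
  (forall x, 0 < x -> Rabs (a x) <= b x) ->
  Rabs (A v - A w) <= B v - B w.
Proof.
intros Hwv HA HB Hab.
destruct (Rle_lt_or_eq_dec w v (proj2 Hwv)) as [Hlt | ->].
2:{ replace (A v - A v) with 0 by ring. rewrite Rabs_R0; lra. }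
destruct (is_derive_mvt (fun x => B x - A x) (fun x => b x - a x) w v) as [c [Hc Ec]].
- lra.
- intros x Hx; apply (is_derive_minus B A x (b x) (a x)); auto.
- destruct (is_derive_mvt (fun x => B x + A x) (fun x => b x + a x) w v) as [d [Hd Ed]].
  + lra.
  + intros x Hx; apply (is_derive_plus B A x (b x) (a x)); auto.
  + pose proof (Hab c ltac:(lra)) as Pc; pose proof (Hab d ltac:(lra)) as Pd.
    apply Rabs_le_between in Pc; apply Rabs_le_between in Pd.
    apply Rabs_le; split; nra.
Qed.

(** A negative [r] is allowed and describes decay at infinity: [C / r] and the difference of powers
    are then both nonpositive. *)
Lemma derive_power_bound (A a : R -> R) (C r w v : R) : r <> 0 -> 0 < w <= v ->
  (forall x, 0 < x -> is_derive A x (a x)) ->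
  (forall x, 0 < x -> Rabs (a x) <= C * Rpower x (r - 1)) ->
  Rabs (A v - A w) <= C / r * (Rpower v r - Rpower w r).
Proof.
intros Hr Hwv HA Ha.
replace (C / r * (Rpower v r - Rpower w r))
  with (C * (Rpower v r / r) - C * (Rpower w r / r)) by (field; exact Hr).
apply (derive_dominated A a (fun x => C * (Rpower x r / r)) (fun x => C * Rpower x (r - 1)));
  auto.
intros x Hx; apply is_derive_scal, is_derive_Rpower_div; auto.
Qed.

Lemma antiderivative_exists (a : R -> R) :
  (forall x, 0 < x -> continuous a x) ->
  exists A, forall x, 0 < x -> is_derive A x (a x).
Proof.
intros Ha; exists (RInt a 1); intros x Hx.
apply (is_derive_RInt a (RInt a 1) 1 x); [|apply Ha, Hx].
assert (Hx2 : 0 < x / 2) by lra.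
exists (mkposreal _ Hx2); intros y Hy.
change (Rabs (y - x) < x / 2) in Hy. apply Rabs_lt_between in Hy.
apply (RInt_correct a 1 y), ex_RInt_continuous.
intros z Hz; apply Ha.
apply Rlt_le_trans with (2 := proj1 Hz), Rmin_glb_lt; lra.
Qed.

(** Letting [m] tend to infinity in the hypothesis keeps the rate, with the same constant. *)
Lemma Cauchy_rate_limit (u : nat -> R) (K r : R) : 0 < r ->
  (forall n m, (n <= m)%nat -> Rabs (u m - u n) <= K * Rpower (INR (S n)) (- r)) ->
  exists l : R, is_lim_seq u l /\
    forall n, Rabs (u n - l) <= K * Rpower (INR (S n)) (- r).
Proof.
intros Hr H.
assert (Hex : ex_finite_lim_seq u).
{ apply ex_lim_seq_cauchy_corr; intros eps.
  assert (He : 0 < eps / 2) by (pose proof (cond_pos eps); lra).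
  destruct (Rpower_large r (Rabs K) (eps / 2) Hr (Rabs_pos K) He) as [M [HM Hx]].
  destruct (INR_unbounded M) as [N HN].
  assert (HN' : forall n, (N <= n)%nat -> Rabs (u n - u N) < eps / 2).
  { intros n Hn; eapply Rle_lt_trans; [apply (H N n Hn)|].
    eapply Rle_lt_trans; [|apply (Hx (INR (S N)))].
    - apply Rmult_le_compat_r; [left; apply Rpower_pos | apply Rle_abs].
    - rewrite S_INR; lra. }
  exists N; intros n m Hn Hm.
  pose proof (HN' n Hn); pose proof (HN' m Hm).
  replace (u n - u m) with ((u n - u N) - (u m - u N)) by ring.
  eapply Rle_lt_trans; [apply Rabs_triang|]. rewrite Rabs_Ropp; lra. }
destruct Hex as [l Hl]; exists l; split; [exact Hl|intros n].
rewrite Rabs_minus_sym.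
apply (is_lim_seq_Rabs_le (fun m => u (m + n)%nat)).
- apply is_lim_seq_incr_n with (N := n) (u := u), Hl.
- intros m; apply H; lia.
Qed.

(** The limit is found along the integers; since the hypothesis compares all pairs of points, it
    carries over to every real [x]. *)
Lemma limit_at_infty (A : R -> R) (K r : R) : 0 < r ->
  (forall w v, 0 < w <= v -> Rabs (A v - A w) <= K * Rpower w (- r)) ->
  exists l, forall x, 0 < x -> Rabs (A x - l) <= K * Rpower x (- r).
Proof.
intros Hr H.
destruct (Cauchy_rate_limit (fun n => A (INR (S n))) K r Hr) as [l [Hl _]].
{ intros n m Hnm; apply H; split; [apply lt_0_INR; lia | apply le_INR; lia]. }
exists l; intros x Hx.
destruct (INR_unbounded x) as [N HN].
rewrite Rabs_minus_sym.
apply (is_lim_seq_Rabs_le (fun m => A (INR (S (m + N))))).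
- apply (is_lim_seq_incr_n (fun n => A (INR (S n))) N), Hl.
- intros m; apply H; split; [exact Hx|].
  apply Rlt_le, Rlt_le_trans with (1 := HN), le_INR; lia.
Qed.

Lemma limit_at_zero (A : R -> R) (K r : R) : 0 < r ->
  (forall w v, 0 < w <= v -> Rabs (A v - A w) <= K * Rpower v r) ->
  exists l, forall x, 0 < x -> Rabs (A x - l) <= K * Rpower x r.
Proof.
intros Hr H.
(* The inversion [x -> / x] exchanges the two ends of the half-line. *)
destruct (limit_at_infty (fun x => A (/ x)) K r Hr) as [l Hl].
{ intros w v Hwv; rewrite <- Rpower_inv_base by lra. rewrite Rabs_minus_sym.
  apply H; split; [apply Rinv_0_lt_compat; lra | apply Rinv_le_contravar; lra]. }
exists l; intros x Hx.
specialize (Hl (/ x) (Rinv_0_lt_compat x Hx)).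
rewrite Rinv_inv, Rpower_inv_base, Ropp_involutive in Hl; auto.
Qed.

(* [A] plays the role of [x |-> int_0^x a]. *)
Lemma antiderivative_at_zero (a : R -> R) (C r : R) : 0 < r ->
  (forall x, 0 < x -> continuous a x) ->
  (forall x, 0 < x -> Rabs (a x) <= C * Rpower x (r - 1)) ->
  exists A, (forall x, 0 < x -> is_derive A x (a x)) /\
    (forall x, 0 < x -> Rabs (A x) <= C / r * Rpower x r).
Proof.
intros Hr Hc Hb.
destruct (antiderivative_exists a Hc) as [B HB].
assert (HC : 0 <= C).
{ specialize (Hb 1 Rlt_0_1); pose proof (Rabs_pos (a 1)); pose proof (Rpower_pos 1 (r - 1)); nra. }
destruct (limit_at_zero B (C / r) r Hr) as [l Hl].
{ intros w v Hwv; eapply Rle_trans; [apply (derive_power_bound B a C r); auto; lra|].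
  apply Rmult_le_compat_l; [apply Rdiv_le_0_compat; lra | pose proof (Rpower_pos w r); lra]. }
exists (fun x => B x - l); split; [intros x Hx|exact Hl].
replace (a x) with (a x - 0) by ring.
apply (is_derive_minus B (fun _ => l) x (a x) 0); [apply HB, Hx | apply is_derive_Reals, derivable_pt_lim_const].
Qed.

(** Compare [A x] with [A w] and let [w] tend to 0. The construction above bounds a primitive for
    one exponent; this lemma bounds one and the same primitive for each exponent that suits its
    derivative. *)
Lemma antiderivative_bound (A a : R -> R) (C r : R) : 0 < r ->
  lim_zero A 0 ->
  (forall x, 0 < x -> is_derive A x (a x)) ->
  (forall x, 0 < x -> Rabs (a x) <= C * Rpower x (r - 1)) ->
  forall x, 0 < x -> Rabs (A x) <= C / r * Rpower x r.
Proof.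
intros Hr H0 HA Ha x Hx.
assert (HC : 0 <= C).
{ specialize (Ha 1 Rlt_0_1); pose proof (Rabs_pos (a 1)); pose proof (Rpower_pos 1 (r - 1)); nra. }
apply Rle_plus_epsilon; intros eps He.
destruct (proj1 (lim_zero_spec A 0) H0 eps He) as [d [Hd Hx']].
set (w := Rmin x (d / 2)).
assert (Hw : 0 < w <= x /\ w < d).
{ unfold w; pose proof (Rmin_l x (d / 2)); pose proof (Rmin_r x (d / 2)).
  assert (0 < Rmin x (d / 2)) by (apply Rmin_glb_lt; lra). lra. }
specialize (Hx' w ltac:(lra)). rewrite Rminus_0_r in Hx'.
pose proof (derive_power_bound A a C r w x ltac:(lra) (proj1 Hw) HA Ha).
replace (A x) with ((A x - A w) + A w) by ring.
eapply Rle_trans; [apply Rabs_triang|].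
assert (C / r * (Rpower x r - Rpower w r) <= C / r * Rpower x r).
{ apply Rmult_le_compat_l; [apply Rdiv_le_0_compat; lra | pose proof (Rpower_pos w r); lra]. }
lra.
Qed.

(** * Improper integrals *)

(** Stated through a primitive so that linearity, dilation and integration by parts become
    operations on primitives. Continuity makes the function Riemann integrable on compact intervals,
    which gives [has_integral_0_inf]. *)
Definition Improper (a : R -> R) (l : R) : Prop :=
  (forall x, 0 < x -> continuous a x) /\
  exists A, (forall x, 0 < x -> is_derive A x (a x)) /\ lim_zero A 0 /\ lim_infty A l.

Lemma Improper_has_integral (a : R -> R) (l : R) : Improper a l -> has_integral_0_inf a l.
Proof.
intros [Hc [A [HA [H0 Hl]]]].
assert (HI : forall u v, 0 < u -> u <= v -> is_RInt a u v (A v - A u)).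
{ intros u v Hu Huv. apply (is_RInt_derive A a);
    rewrite Rmin_left, Rmax_right by lra; intros x Hx; [apply HA | apply Hc]; lra. }
split.
- intros u v Hu Huv. exists (A v - A u).
  assert (pr : Riemann_integrable a u v) by (apply ex_RInt_Reals_0; eexists; apply HI; auto).
  exists pr. rewrite <- RInt_Reals. apply is_RInt_unique, HI; auto.
- intros eps He.
  destruct (proj1 (lim_zero_spec A 0) H0 (eps / 2) ltac:(lra)) as [d [Hd Hd']].
  destruct (proj1 (lim_infty_spec A l) Hl (eps / 2) ltac:(lra)) as [M [HM HM']].
  exists d, (Rmax d M); split; [exact Hd | split; [apply Rmax_l|]].
  intros u v I Hu Hud Hv [pr <-].
  pose proof (Rmax_l d M); pose proof (Rmax_r d M).
  rewrite <- RInt_Reals, (is_RInt_unique _ _ _ _ (HI u v Hu ltac:(lra))).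
  specialize (Hd' u ltac:(lra)); specialize (HM' v ltac:(lra)).
  replace (A v - A u - l) with ((A v - l) - (A u - 0)) by ring.
  eapply Rle_lt_trans; [apply Rabs_triang|]. rewrite Rabs_Ropp; lra.
Qed.

Lemma has_integral_unique (a : R -> R) (l m : R) :
  has_integral_0_inf a l -> has_integral_0_inf a m -> l = m.
Proof.
intros [He Hl] [_ Hm].
apply Rminus_diag_uniq, Rabs_eq_0, Rle_antisym; [|apply Rabs_pos].
apply Rle_plus_epsilon; intros eps Heps; rewrite Rplus_0_l.
destruct (Hl (eps / 2) ltac:(lra)) as [d [M [Hd [HdM H1]]]].
destruct (Hm (eps / 2) ltac:(lra)) as [d' [M' [Hd' [HdM' H2]]]].
set (u := Rmin d d' / 2). set (v := Rmax M M' + 1).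
pose proof (Rmin_l d d'); pose proof (Rmin_r d d').
pose proof (Rmax_l M M'); pose proof (Rmax_r M M').
assert (0 < Rmin d d') by (apply Rmin_glb_lt; lra).
destruct (He u v ltac:(unfold u; lra) ltac:(unfold u, v; lra)) as [I HI].
specialize (H1 u v I ltac:(unfold u; lra) ltac:(unfold u; lra) ltac:(unfold v; lra) HI).
specialize (H2 u v I ltac:(unfold u; lra) ltac:(unfold u; lra) ltac:(unfold v; lra) HI).
replace (l - m) with ((I - m) - (I - l)) by ring.
eapply Rle_trans; [apply Rabs_triang|]. rewrite Rabs_Ropp; lra.
Qed.

Lemma Improper_unique (a : R -> R) (l m : R) : Improper a l -> Improper a m -> l = m.
Proof.
intros Hl Hm; apply (has_integral_unique a); apply Improper_has_integral; assumption.
Qed.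

Lemma locally_pos (x : R) (P : R -> Prop) :
  0 < x -> (forall y, 0 < y -> P y) -> locally x P.
Proof.
intros Hx HP; exists (mkposreal x Hx); intros y Hy.
change (Rabs (y - x) < x) in Hy. apply Rabs_lt_between in Hy. apply HP; lra.
Qed.

Lemma Improper_ext (a b : R -> R) (l : R) :
  (forall x, 0 < x -> a x = b x) -> Improper a l -> Improper b l.
Proof.
intros Hab [Hc [A [HA H]]]; split.
- intros x Hx; apply (continuous_ext_loc b a x); [apply locally_pos; auto | apply Hc, Hx].
- exists A; split; [|exact H]. intros x Hx; rewrite <- Hab by exact Hx; apply HA, Hx.
Qed.

Lemma Improper_plus (a b : R -> R) (l m : R) :
  Improper a l -> Improper b m -> Improper (fun x => a x + b x) (l + m).
Proof.
intros [Hc [A [HA [HA0 HAl]]]] [Hd [B [HB [HB0 HBl]]]]; split.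
- intros x Hx; apply (continuous_plus a b); auto.
- exists (fun x => A x + B x); split; [|split].
  + intros x Hx; apply (is_derive_plus A B); auto.
  + replace 0 with (0 + 0) by ring.
    apply (filterlim_comp_2 (G := locally 0) (H := locally 0) A B Rplus HA0 HB0), (filterlim_plus (V := R_NormedModule) 0 0).
  + apply (filterlim_comp_2 (G := locally l) (H := locally m) A B Rplus HAl HBl), (filterlim_plus (V := R_NormedModule) l m).
Qed.

Lemma Improper_scal (c : R) (a : R -> R) (l : R) :
  Improper a l -> Improper (fun x => c * a x) (c * l).
Proof.
intros [Hc [A [HA [HA0 HAl]]]]; split.
- intros x Hx; apply (continuous_scal_r c a); auto.
- exists (fun x => c * A x); split; [|split].
  + intros x Hx; apply is_derive_scal; auto.
  + unfold lim_zero; rewrite <- (Rmult_0_r c) at 2.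
    apply (filterlim_comp _ _ _ A (Rmult c) _ (locally 0)); [exact HA0|].
    apply (filterlim_scal_r (V := R_NormedModule) c 0).
  + apply (filterlim_comp _ _ _ A (Rmult c) _ (locally l)); [exact HAl|].
    apply (filterlim_scal_r (V := R_NormedModule) c l).
Qed.

Lemma is_derive_comp_scal (A : R -> R) (c x d : R) :
  is_derive A (c * x) d -> is_derive (fun y => A (c * y)) x (c * d).
Proof.
intros H; apply (is_derive_comp A (fun y => c * y) x d c H).
auto_derive; [exact I | ring].
Qed.

Lemma continuous_comp_scal (a : R -> R) (c x : R) :
  continuous a (c * x) -> continuous (fun y => a (c * y)) x.
Proof.
intros H; apply (continuous_comp (fun y => c * y) a); [|exact H].
apply (continuous_scal_r c (fun y : R => y)), continuous_id.
Qed.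

Lemma Improper_dilate (c : R) (a : R -> R) (l : R) : 0 < c ->
  Improper a l -> Improper (fun x => a (c * x)) (l / c).
Proof.
intros Hc0 [Hc [A [HA [HA0 HAl]]]]; split.
- intros x Hx; apply continuous_comp_scal, Hc, Rmult_lt_0_compat; auto.
- assert (Hi : 0 < / c) by (apply Rinv_0_lt_compat, Hc0).
  exists (fun x => / c * A (c * x)); split; [|split].
  + intros x Hx.
    replace (a (c * x)) with (/ c * (c * a (c * x))) by (field; lra).
    apply is_derive_scal, is_derive_comp_scal, HA, Rmult_lt_0_compat; auto.
  + apply lim_zero_spec; intros eps He.
    destruct (proj1 (lim_zero_spec A 0) HA0 (c * eps) ltac:(nra)) as [d [Hd Hx]].
    exists (d / c); split; [apply Rdiv_lt_0_compat; lra | intros x Hxd].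
    assert (c * x < d).
    { apply Rmult_lt_reg_l with (/ c); [exact Hi|].
      replace (/ c * (c * x)) with x by (field; lra). unfold Rdiv in Hxd; lra. }
    specialize (Hx (c * x) ltac:(nra)). rewrite Rminus_0_r in *.
    rewrite Rabs_mult, (Rabs_pos_eq (/ c)) by lra.
    apply Rmult_lt_reg_l with c; [exact Hc0|].
    rewrite <- Rmult_assoc, Rinv_r, Rmult_1_l by lra; exact Hx.
  + apply lim_infty_spec; intros eps He.
    destruct (proj1 (lim_infty_spec A l) HAl (c * eps) ltac:(nra)) as [M [HM Hx]].
    exists (M / c); split; [apply Rdiv_lt_0_compat; lra | intros x Hxd].
    assert (M < c * x).
    { apply Rmult_lt_reg_l with (/ c); [exact Hi|].
      replace (/ c * (c * x)) with x by (field; lra). unfold Rdiv in Hxd; lra. }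
    specialize (Hx (c * x) ltac:(nra)).
    replace (/ c * A (c * x) - l / c) with (/ c * (A (c * x) - l)) by (field; lra).
    rewrite Rabs_mult, (Rabs_pos_eq (/ c)) by lra.
    apply Rmult_lt_reg_l with c; [exact Hc0|].
    rewrite <- Rmult_assoc, Rinv_r, Rmult_1_l by lra; exact Hx.
Qed.

(** The first bound is integrable at 0, the second at infinity. One constant for both makes the
    bound on the integral linear in [C], so that a pointwise rate of convergence becomes a rate for
    the integrals. *)
Definition tame (e C : R) (a : R -> R) : Prop :=
  (forall x, 0 < x -> continuous a x) /\
  forall x, 0 < x -> Rabs (a x) <= C * Rpower x (e - 1) /\ Rabs (a x) <= C * Rpower x (- e - 1).

Lemma tame_antiderivative (e C : R) (a : R -> R) : 0 < e -> tame e C a ->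
  exists A l, (forall x, 0 < x -> is_derive A x (a x)) /\
    forall x, 0 < x -> Rabs (A x) <= C / e * Rpower x e /\
                       Rabs (A x - l) <= C / e * Rpower x (- e).
Proof.
intros He [Hc Hb].
destruct (antiderivative_at_zero a C e He Hc (fun x Hx => proj1 (Hb x Hx))) as [A [HA HA0]].
destruct (limit_at_infty A (C / e) e He) as [l Hl].
{ intros w v Hwv.
  eapply Rle_trans; [apply (derive_power_bound A a C (- e)); auto; [lra|]|].
  - intros x Hx; apply (proj2 (Hb x Hx)).
  - assert (HC : 0 <= C).
    { destruct (Hb 1 Rlt_0_1) as [H1 _]; pose proof (Rabs_pos (a 1));
      pose proof (Rpower_pos 1 (e - 1)); nra. }
    replace (C / - e * (Rpower v (- e) - Rpower w (- e)))
      with (C / e * (Rpower w (- e) - Rpower v (- e))) by (field; lra).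
    apply Rmult_le_compat_l; [apply Rdiv_le_0_compat; lra | pose proof (Rpower_pos v (- e)); lra]. }
exists A, l; split; auto.
Qed.

Lemma tame_Improper (e C : R) (a : R -> R) : 0 < e -> tame e C a ->
  exists l, Improper a l /\ Rabs l <= 2 * (C / e).
Proof.
intros He Ha.
destruct (tame_antiderivative e C a He Ha) as [A [l [HA Hb]]].
exists l; split; [split; [apply Ha | exists A; split; [exact HA | split]]|].
- apply (lim_zero_of_bound A 0 (C / e) e He). intros x Hx; rewrite Rminus_0_r; apply Hb, Hx.
- apply (lim_infty_of_bound A l (C / e) e He). intros x Hx; apply Hb, Hx.
(* At [x = 1] all powers equal 1, so each half of the integral contributes at most [C / e]. *)
- destruct (Hb 1 Rlt_0_1) as [H1 H2].
  unfold Rpower in H1, H2; rewrite ln_1, Rmult_0_r, exp_0 in *.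
  replace l with (A 1 - (A 1 - l)) by ring.
  eapply Rle_trans; [apply Rabs_triang|]. rewrite Rabs_Ropp; lra.
Qed.

Definition ImproperC (h : R -> Cplx) (l : Cplx) : Prop :=
  Improper (fun x => Cre (h x)) (Cre l) /\ Improper (fun x => Cim (h x)) (Cim l).

Lemma ImproperC_has_integral (h : R -> Cplx) (l : Cplx) :
  ImproperC h l -> has_integral_0_inf_C h l.
Proof. intros [H1 H2]; split; apply Improper_has_integral; assumption. Qed.

Lemma ImproperC_integral (h : R -> Cplx) (l : Cplx) : ImproperC h l -> integral_0_inf_C h = l.
Proof.
intros H; apply ImproperC_has_integral in H.
assert (H' : has_integral_0_inf_C h (integral_0_inf_C h)).
{ unfold integral_0_inf_C; apply epsilon_spec; exists l; exact H. }
apply injective_projections; [apply (has_integral_unique _ _ _ (proj1 H') (proj1 H))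
  | apply (has_integral_unique _ _ _ (proj2 H') (proj2 H))].
Qed.

Lemma ImproperC_unique (h : R -> Cplx) (l m : Cplx) : ImproperC h l -> ImproperC h m -> l = m.
Proof.
intros [H1 H2] [H3 H4]; apply injective_projections; eapply Improper_unique; eassumption.
Qed.

Lemma ImproperC_ext (h k : R -> Cplx) (l : Cplx) :
  (forall x, 0 < x -> h x = k x) -> ImproperC h l -> ImproperC k l.
Proof.
intros E [H1 H2]; split; [revert H1 | revert H2]; apply Improper_ext;
  intros x Hx; rewrite E by exact Hx; reflexivity.
Qed.

Lemma ImproperC_plus (h k : R -> Cplx) (l m : Cplx) :
  ImproperC h l -> ImproperC k m -> ImproperC (fun x => Cadd (h x) (k x)) (Cadd l m).
Proof. intros [H1 H2] [H3 H4]; split; apply Improper_plus; assumption. Qed.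

Lemma ImproperC_mult (c : Cplx) (h : R -> Cplx) (l : Cplx) :
  ImproperC h l -> ImproperC (fun x => Cmul c (h x)) (Cmul c l).
Proof.
intros [H1 H2]; split; simpl.
- replace (Cre c * Cre l - Cim c * Cim l) with (Cre c * Cre l + - Cim c * Cim l) by ring.
  apply (Improper_ext (fun x => Cre c * Cre (h x) + - Cim c * Cim (h x))); [intros; ring|].
  apply Improper_plus; apply Improper_scal; assumption.
- apply Improper_plus; apply Improper_scal; assumption.
Qed.

Lemma ImproperC_dilate (c : R) (h : R -> Cplx) (l : Cplx) : 0 < c ->
  ImproperC h l -> ImproperC (fun x => h (c * x)) (Cmul (RtoC (/ c)) l).
Proof.
intros Hc [H1 H2]; split; simpl.
- replace (/ c * Cre l - 0 * Cim l) with (Cre l / c) by (unfold Rdiv; ring).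
  apply (Improper_dilate c (fun x => Cre (h x))); assumption.
- replace (/ c * Cim l + 0 * Cre l) with (Cim l / c) by (unfold Rdiv; ring).
  apply (Improper_dilate c (fun x => Cim (h x))); assumption.
Qed.

(** * Differences between sums and integrals *)

Fixpoint psum (a : nat -> R) (N : nat) : R :=
  match N with O => 0 | S n => psum a n + a n end.

Lemma psum_sum_f_R0 (a : nat -> R) (n : nat) : sum_f_R0 a n = psum a (S n).
Proof. induction n as [|n IH]; [simpl; ring | rewrite tech5, IH; reflexivity]. Qed.

Lemma psum_ext (a b : nat -> R) (N : nat) :
  (forall k, (k < N)%nat -> a k = b k) -> psum a N = psum b N.
Proof.
induction N as [|n IH]; intros H; simpl; [reflexivity|].
rewrite IH, H; [reflexivity | lia | intros k Hk; apply H; lia].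
Qed.

Lemma psum_plus (a b : nat -> R) (N : nat) :
  psum (fun k => a k + b k) N = psum a N + psum b N.
Proof. induction N as [|n IH]; simpl; [ring | rewrite IH; ring]. Qed.

Lemma psum_scal (c : R) (a : nat -> R) (N : nat) : psum (fun k => c * a k) N = c * psum a N.
Proof. induction N as [|n IH]; simpl; [ring | rewrite IH; ring]. Qed.

Lemma psum_le (a b : nat -> R) (N : nat) :
  (forall k, (k < N)%nat -> a k <= b k) -> psum a N <= psum b N.
Proof.
induction N as [|n IH]; intros H; simpl; [lra|].
apply Rplus_le_compat; [apply IH; intros k Hk; apply H; lia | apply H; lia].
Qed.

Lemma psum_Rabs (a : nat -> R) (N : nat) : Rabs (psum a N) <= psum (fun k => Rabs (a k)) N.
Proof.
induction N as [|n IH]; simpl; [rewrite Rabs_R0; lra|].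
eapply Rle_trans; [apply Rabs_triang | lra].
Qed.

Lemma psum_derive (a a' : nat -> R -> R) (N : nat) (x : R) :
  (forall k, is_derive (a k) x (a' k x)) ->
  is_derive (fun y => psum (fun k => a k y) N) x (psum (fun k => a' k x) N).
Proof.
intros H; induction N as [|n IH]; simpl.
- apply is_derive_Reals, derivable_pt_lim_const.
- apply (is_derive_plus (fun y => psum (fun k => a k y) n) (a n)); auto.
Qed.

Lemma psum_continuous (a : nat -> R -> R) (N : nat) (x : R) :
  (forall k, continuous (a k) x) -> continuous (fun y => psum (fun k => a k y) N) x.
Proof.
intros H; induction N as [|n IH]; simpl; [apply continuous_const|].
apply (continuous_plus (fun y => psum (fun k => a k y) n) (a n)); auto.
Qed.

Lemma INR_S_pos (n : nat) : 0 < INR (S n).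
Proof. apply lt_0_INR; lia. Qed.

(* For [G x = int_0^x g], this is [sum_(1 <= n <= N) g (n x) - int_0^N g (x y) dy]. *)
Definition muntz (g G : R -> R) (N : nat) (x : R) : R :=
  psum (fun k => g (INR (S k) * x)) N - G (INR N * x) / x.

(** The sequence starts at [N = 1], because at [N = 0] it would involve [G 0], on which the
    hypotheses below say nothing. *)
Definition muntz_lim (g G : R -> R) (x : R) : R :=
  real (Lim_seq (fun n => muntz g G (S n) x)).

(** The second clause is the integrated form of [|g' x| <= C p x^(-p-1)]. Unlike the bound on the
    derivative, it survives pointwise limits. The primitive need not vanish at 0 here, so [/ x] with
    primitive [ln] qualifies. *)
Definition controlled (p C : R) (g G : R -> R) : Prop :=
  (forall x, 0 < x -> is_derive G x (g x)) /\
  (forall w v, 0 < w <= v -> Rabs (g v - g w) <= C * (Rpower w (- p) - Rpower v (- p))).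

(* [G] is the primitive of [g] that vanishes at 0. *)
Definition admissible (p C : R) (g G : R -> R) : Prop :=
  controlled p C g G /\
  (forall x, 0 < x -> Rabs (g x) <= C * Rpower x (- p)) /\
  (forall x, 0 < x -> Rabs (G x) <= C * Rpower x (1 - p)).

Lemma controlled_derive (p C : R) (g g' G : R -> R) : 0 < p ->
  (forall x, 0 < x -> is_derive G x (g x)) ->
  (forall x, 0 < x -> is_derive g x (g' x)) ->
  (forall x, 0 < x -> Rabs (g' x) <= C * p * Rpower x (- p - 1)) ->
  controlled p C g G.
Proof.
intros Hp HG Hg Hb; split; [exact HG | intros w v Hwv].
eapply Rle_trans; [apply (derive_power_bound g g' (C * p) (- p)); auto; lra|].
apply Req_le; field; lra.
Qed.

Lemma controlled_continuous (p C : R) (g G : R -> R) (x : R) :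
  controlled p C g G -> 0 < x -> continuous g x.
Proof.
intros [_ Hv] Hx.
apply filterlim_locally; intros eps.
assert (Hc : continuous (fun y => C * Rpower y (- p)) x).
{ apply (continuous_scal_r C (fun y => Rpower y (- p))), (ex_derive_continuous (fun y => Rpower y (- p))).
  eexists; apply is_derive_Rpower, Hx. }
generalize (filter_and _ _ (proj1 (filterlim_locally _ _) Hc eps) (locally_pos x (fun y => 0 < y) Hx (fun y H => H))).
apply filter_imp; intros y [Hy Hy0].
change (Rabs (C * Rpower y (- p) - C * Rpower x (- p)) < eps) in Hy.
change (Rabs (g y - g x) < eps).
eapply Rle_lt_trans; [|exact Hy].
destruct (Rle_lt_dec x y).
- eapply Rle_trans; [apply Hv; lra|]. rewrite Rabs_minus_sym.
  eapply Rle_trans; [|apply Rle_abs]. lra.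
- rewrite Rabs_minus_sym. eapply Rle_trans; [apply Hv; lra|].
  eapply Rle_trans; [|apply Rle_abs]. lra.
Qed.

(* The mean value theorem replaces the integral over [n x, (n + 1) x] by a value of [g]. *)
Lemma muntz_step (p C : R) (g G : R -> R) (n : nat) (x : R) : 0 < p -> 0 <= C ->
  controlled p C g G -> 0 < x ->
  Rabs (muntz g G (S (S n)) x - muntz g G (S n) x) <=
    C * (Rpower (INR (S n) * x) (- p) - Rpower (INR (S (S n)) * x) (- p)).
Proof.
intros Hp HC [HG Hv] Hx.
pose proof (INR_S_pos n) as Hn.
assert (Hw : 0 < INR (S n) * x) by (apply Rmult_lt_0_compat; assumption).
assert (Hvw : INR (S (S n)) * x = INR (S n) * x + x) by (rewrite (S_INR (S n)); ring).
destruct (is_derive_mvt G g (INR (S n) * x) (INR (S (S n)) * x)) as [c [Hc E]]; [lra | exact HG |].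
replace (muntz g G (S (S n)) x - muntz g G (S n) x) with (g (INR (S (S n)) * x) - g c).
2:{ unfold muntz; change (psum (fun k => g (INR (S k) * x)) (S (S n)))
      with (psum (fun k => g (INR (S k) * x)) (S n) + g (INR (S (S n)) * x)).
    replace (G (INR (S (S n)) * x)) with (G (INR (S n) * x) + g c * x)
      by (rewrite Hvw in E |- *; lra).
    field; lra. }
eapply Rle_trans; [apply Hv; lra|].
apply Rmult_le_compat_l; [exact HC|].
pose proof (Rpower_ge_base (INR (S n) * x) c (- p)); lra.
Qed.

Lemma muntz_cauchy (p C : R) (g G : R -> R) (n m : nat) (x : R) : 0 < p -> 0 <= C ->
  controlled p C g G -> 0 < x -> (n <= m)%nat ->
  Rabs (muntz g G (S m) x - muntz g G (S n) x) <=
    C * Rpower x (- p) * Rpower (INR (S n)) (- p).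
Proof.
intros Hp HC Hg Hx Hnm.
(* The induction needs both terms of the telescoped bound; the one at [S m] is dropped only
   afterwards. *)
assert (H : Rabs (muntz g G (S m) x - muntz g G (S n) x) <=
  C * (Rpower (INR (S n) * x) (- p) - Rpower (INR (S m) * x) (- p))).
{ induction Hnm as [|m Hnm IH].
  - replace (muntz g G (S n) x - muntz g G (S n) x) with 0 by ring. rewrite Rabs_R0; lra.
  - pose proof (muntz_step p C g G m x Hp HC Hg Hx).
    replace (muntz g G (S (S m)) x - muntz g G (S n) x) with
      ((muntz g G (S (S m)) x - muntz g G (S m) x) + (muntz g G (S m) x - muntz g G (S n) x)) by ring.
    eapply Rle_trans; [apply Rabs_triang | lra]. }
eapply Rle_trans; [exact H|].
rewrite Rmult_assoc; apply Rmult_le_compat_l; [exact HC|].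
rewrite Rpower_mult_distr by (try apply INR_S_pos; assumption).
rewrite (Rmult_comm x). pose proof (Rpower_pos (INR (S m) * x) (- p)); lra.
Qed.

Lemma muntz_limit (p C : R) (g G : R -> R) (x : R) : 0 < p -> 0 <= C ->
  controlled p C g G -> 0 < x ->
  is_lim_seq (fun n => muntz g G (S n) x) (muntz_lim g G x) /\
  forall n, Rabs (muntz g G (S n) x - muntz_lim g G x) <=
    C * Rpower x (- p) * Rpower (INR (S n)) (- p).
Proof.
intros Hp HC Hg Hx.
destruct (Cauchy_rate_limit (fun n => muntz g G (S n) x) (C * Rpower x (- p)) p Hp) as [l [Hl Hr]].
{ intros n m Hnm; apply muntz_cauchy; assumption. }
replace (muntz_lim g G x) with l by (unfold muntz_lim; rewrite (is_lim_seq_unique _ _ Hl); reflexivity).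
split; assumption.
Qed.

Lemma admissible_const_pos (p C : R) (g G : R -> R) : admissible p C g G -> 0 <= C.
Proof.
intros [_ [H _]]; specialize (H 1 Rlt_0_1).
pose proof (Rabs_pos (g 1)); pose proof (Rpower_pos 1 (- p)); nra.
Qed.

(** Everything is compared with [N = 1]: there the value is [g x - G x / x], at most [2 C x^(-p)] in
    size, and the Cauchy estimate adds one more [C x^(-p)]. *)
Lemma muntz_bound (p C : R) (g G : R -> R) (n : nat) (x : R) : 0 < p ->
  admissible p C g G -> 0 < x -> Rabs (muntz g G (S n) x) <= 3 * C * Rpower x (- p).
Proof.
intros Hp Hg Hx.
pose proof (admissible_const_pos _ _ _ _ Hg) as HC.
destruct Hg as [Hg [Hb HG]].
assert (H1 : Rabs (muntz g G 1 x) <= 2 * C * Rpower x (- p)).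
{ unfold muntz; simpl; rewrite Rplus_0_l, Rmult_1_l.
  eapply Rle_trans; [apply Rabs_triang|]. rewrite Rabs_Ropp, Rabs_div by lra.
  rewrite (Rabs_pos_eq x) by lra.
  specialize (Hb x Hx); specialize (HG x Hx).
  assert (Rabs (G x) / x <= C * Rpower x (- p)); [|lra].
  apply Rle_div_l; [lra|]. eapply Rle_trans; [exact HG|].
  rewrite Rmult_assoc; rewrite <- (Rpower_1 x) at 3 by exact Hx.
  rewrite <- Rpower_plus. apply Req_le; do 2 f_equal; ring. }
pose proof (muntz_cauchy p C g G 0 n x Hp HC Hg Hx ltac:(lia)) as H2.
replace (muntz g G (S n) x) with ((muntz g G (S n) x - muntz g G 1 x) + muntz g G 1 x) by ring.
eapply Rle_trans; [apply Rabs_triang|].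
assert (Rpower (INR 1) (- p) = 1) by (unfold Rpower; simpl; rewrite ln_1, Rmult_0_r, exp_0; reflexivity).
rewrite H in H2; lra.
Qed.

(** The rate degenerates as [y] tends to 0 but is uniform on [y > x / 2], and a locally uniform
    limit of continuous functions is continuous. *)
Lemma continuous_of_rate (u : nat -> R -> R) (G : R -> R) (K p x : R) : 0 < p -> 0 <= K ->
  (forall n y, 0 < y -> continuous (u n) y) ->
  (forall n y, 0 < y -> Rabs (u n y - G y) <= K * Rpower y (- p) * Rpower (INR (S n)) (- p)) ->
  0 < x -> continuous G x.
Proof.
intros Hp HK Hu HG Hx.
apply filterlim_locally; intros eps.
assert (He : 0 < eps / 3) by (pose proof (cond_pos eps); lra).
assert (HK' : 0 <= K * Rpower (x / 2) (- p)) by (apply Rmult_le_pos; [lra | left; apply Rpower_pos]).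
destruct (Rpower_large p (K * Rpower (x / 2) (- p)) (eps / 3) Hp HK' He) as [M [HM HM']].
destruct (INR_unbounded M) as [n Hn].
assert (Hn' : forall y, x / 2 < y -> Rabs (u n y - G y) < eps / 3).
{ intros y Hy; eapply Rle_lt_trans; [apply HG; lra|].
  eapply Rle_lt_trans; [|apply (HM' (INR (S n))); rewrite S_INR; lra].
  apply Rmult_le_compat_r; [left; apply Rpower_pos|].
  apply Rmult_le_compat_l; [exact HK | apply Rpower_ge_base; lra]. }
assert (Hl : locally x (fun y => x / 2 < y)).
{ assert (Hx2 : 0 < x / 2) by lra. exists (mkposreal _ Hx2); intros y Hy.
  change (Rabs (y - x) < x / 2) in Hy. apply Rabs_lt_between in Hy; lra. }
generalize (filter_and _ _ (proj1 (filterlim_locally _ _) (Hu n x Hx) (mkposreal _ He)) Hl).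
apply filter_imp; intros y [Hy Hy0].
change (Rabs (u n y - u n x) < eps / 3) in Hy.
change (Rabs (G y - G x) < eps).
pose proof (Hn' y Hy0); pose proof (Hn' x ltac:(lra)).
replace (G y - G x) with (- (u n y - G y) + ((u n y - u n x) + (u n x - G x))) by ring.
eapply Rle_lt_trans; [apply Rabs_triang|]. rewrite Rabs_Ropp.
pose proof (Rabs_triang (u n y - u n x) (u n x - G x)); lra.
Qed.

Lemma muntz_continuous (p C : R) (g G : R -> R) (n : nat) (x : R) :
  controlled p C g G -> 0 < x -> continuous (muntz g G (S n)) x.
Proof.
intros Hg Hx.
apply (continuous_minus (fun y => psum (fun k => g (INR (S k) * y)) (S n))
  (fun y => G (INR (S n) * y) / y)).
- apply (psum_continuous (fun k y => g (INR (S k) * y))); intros k.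
  apply continuous_comp_scal, (controlled_continuous p C g G); auto.
  apply Rmult_lt_0_compat; [apply INR_S_pos | exact Hx].
- apply (continuous_mult (fun y => G (INR (S n) * y)) (fun y => / y)).
  + apply continuous_comp_scal, (ex_derive_continuous G); eexists; apply (proj1 Hg).
    apply Rmult_lt_0_compat; [apply INR_S_pos | exact Hx].
  + apply (ex_derive_continuous Rinv); auto_derive; lra.
Qed.

Lemma muntz_lim_continuous (p C : R) (g G : R -> R) (x : R) : 0 < p -> 0 <= C ->
  controlled p C g G -> 0 < x -> continuous (muntz_lim g G) x.
Proof.
intros Hp HC Hg Hx.
apply (continuous_of_rate (fun n => muntz g G (S n)) _ C p x Hp HC); [| |exact Hx].
- intros n y Hy; apply (muntz_continuous p C); assumption.
- intros n y Hy; apply (muntz_limit p C); assumption.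
Qed.

(** * The zeta function in the critical strip *)

Ltac Cplx_ext := apply injective_projections; simpl; unfold Cre, Cim; simpl.

Lemma Cplx_ring_theory :
  ring_theory (RtoC 0) (RtoC 1) Cadd Cmul Csub (Csub (RtoC 0)) (@eq Cplx).
Proof.
constructor; intros; unfold Cadd, Cmul, Csub, RtoC; Cplx_ext; ring.
Qed.

Add Ring Cplx_ring : Cplx_ring_theory.

Definition Cinv (z : Cplx) : Cplx :=
  (Cre z / (Cre z ^ 2 + Cim z ^ 2), - Cim z / (Cre z ^ 2 + Cim z ^ 2)).

Lemma Cinv_r (z : Cplx) : Cre z ^ 2 + Cim z ^ 2 <> 0 -> Cmul z (Cinv z) = RtoC 1.
Proof.
intros H; destruct z as [a b]; unfold Cmul, Cinv, RtoC; simpl in *.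
Cplx_ext; field; intros E; apply H; rewrite <- E; ring.
Qed.

Lemma RtoC_mult (a b : R) : RtoC (a * b) = Cmul (RtoC a) (RtoC b).
Proof. unfold RtoC, Cmul; Cplx_ext; ring. Qed.

Lemma RtoC_plus (a b : R) : RtoC (a + b) = Cadd (RtoC a) (RtoC b).
Proof. unfold RtoC, Cadd; Cplx_ext; ring. Qed.

Lemma RtoC_minus (a b : R) : RtoC (a - b) = Csub (RtoC a) (RtoC b).
Proof. unfold RtoC, Csub; Cplx_ext; ring. Qed.

Lemma Cpow_eq (x : R) (z : Cplx) : Cpow x z =
  (Rpower x (Cre z) * cos (Cim z * ln x), Rpower x (Cre z) * sin (Cim z * ln x)).
Proof.
unfold Cpow, Cexp, Cmul, RtoC, Rpower; simpl.
replace (ln x * Cre z - 0 * Cim z) with (Cre z * ln x) by ring.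
replace (ln x * Cim z + 0 * Cre z) with (Cim z * ln x) by ring. reflexivity.
Qed.

Lemma Cpow_add (x : R) (z w : Cplx) : Cpow x (Cadd z w) = Cmul (Cpow x z) (Cpow x w).
Proof.
rewrite !Cpow_eq; unfold Cmul, Cadd; simpl.
rewrite Rpower_plus, Rmult_plus_distr_r, cos_plus, sin_plus; Cplx_ext; ring.
Qed.

Lemma Cpow_base_mult (x y : R) (z : Cplx) : 0 < x -> 0 < y ->
  Cpow (x * y) z = Cmul (Cpow x z) (Cpow y z).
Proof.
intros Hx Hy; rewrite !Cpow_eq; unfold Cmul; simpl.
rewrite ln_mult, <- Rpower_mult_distr, Rmult_plus_distr_l, cos_plus, sin_plus by assumption.
Cplx_ext; ring.
Qed.

Lemma Cpow_one (x : R) : 0 < x -> Cpow x (RtoC 1) = RtoC x.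
Proof.
intros Hx; rewrite Cpow_eq; simpl; rewrite Rpower_1 by exact Hx.
rewrite Rmult_0_l, cos_0, sin_0; unfold RtoC; Cplx_ext; ring.
Qed.

Lemma Cpow_zero (x : R) : Cpow x (RtoC 0) = RtoC 1.
Proof.
rewrite Cpow_eq; simpl; unfold Rpower; rewrite !Rmult_0_l, cos_0, sin_0, exp_0.
unfold RtoC; Cplx_ext; ring.
Qed.

Lemma Cpow_sub_one (x : R) (z : Cplx) : 0 < x ->
  Cpow x (Csub z (RtoC 1)) = Cmul (RtoC (/ x)) (Cpow x z).
Proof.
intros Hx.
replace (Cpow x z) with (Cmul (Cpow x (Csub z (RtoC 1))) (RtoC x)).
2:{ rewrite <- (Cpow_one x Hx), <- Cpow_add; f_equal; ring. }
transitivity (Cmul (RtoC (/ x * x)) (Cpow x (Csub z (RtoC 1)))).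
- rewrite Rinv_l by lra; ring.
- rewrite RtoC_mult; ring.
Qed.

Lemma Rabs_cos_le (x : R) : Rabs (cos x) <= 1.
Proof. apply Rabs_le, COS_bound. Qed.

Lemma Rabs_sin_le (x : R) : Rabs (sin x) <= 1.
Proof. apply Rabs_le, SIN_bound. Qed.

Lemma Cpow_bound (x : R) (z : Cplx) :
  Rabs (Cre (Cpow x z)) <= Rpower x (Cre z) /\ Rabs (Cim (Cpow x z)) <= Rpower x (Cre z).
Proof.
rewrite Cpow_eq; unfold Cre at 1, Cim at 2; simpl.
rewrite !Rabs_mult, (Rabs_pos_eq (Rpower _ _)) by (left; apply Rpower_pos).
pose proof (Rpower_pos x (Cre z)).
pose proof (Rabs_cos_le (Cim z * ln x)); pose proof (Rabs_sin_le (Cim z * ln x)).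
split; nra.
Qed.

Lemma Cmul_Cpow_bound (c z : Cplx) (x : R) :
  Rabs (Cre (Cmul c (Cpow x z))) <= (Rabs (Cre c) + Rabs (Cim c)) * Rpower x (Cre z) /\
  Rabs (Cim (Cmul c (Cpow x z))) <= (Rabs (Cre c) + Rabs (Cim c)) * Rpower x (Cre z).
Proof.
destruct (Cpow_bound x z) as [H1 H2].
pose proof (fun u => Rmult_le_compat_l (Rabs u) _ _ (Rabs_pos u) H1) as M1.
pose proof (fun u => Rmult_le_compat_l (Rabs u) _ _ (Rabs_pos u) H2) as M2.
rewrite Rmult_plus_distr_r.
unfold Cmul, Cre at 1, Cim at 4; cbn [fst snd]; split.
- eapply Rle_trans; [apply Rabs_triang|]. rewrite Rabs_Ropp, !Rabs_mult.
  apply Rplus_le_compat; auto.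
- eapply Rle_trans; [apply Rabs_triang|]. rewrite !Rabs_mult.
  apply Rplus_le_compat; auto.
Qed.

Lemma is_derive_Cpow (c z : Cplx) (x : R) : 0 < x ->
  is_derive (fun y => Cre (Cmul c (Cpow y z))) x
    (Cre (Cmul (Cmul c z) (Cpow x (Csub z (RtoC 1))))) /\
  is_derive (fun y => Cim (Cmul c (Cpow y z))) x
    (Cim (Cmul (Cmul c z) (Cpow x (Csub z (RtoC 1))))).
Proof.
intros Hx; rewrite Cpow_sub_one by exact Hx.
destruct c as [c d], z as [a b]; split.
- apply (is_derive_ext (fun y => c * (Rpower y a * cos (b * ln y)) - d * (Rpower y a * sin (b * ln y)))).
  { intros y; rewrite Cpow_eq; reflexivity. }
  rewrite Cpow_eq; unfold Rpower; auto_derive; [repeat split; exact Hx|].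
  simpl; field; lra.
- apply (is_derive_ext (fun y => c * (Rpower y a * sin (b * ln y)) + d * (Rpower y a * cos (b * ln y)))).
  { intros y; rewrite Cpow_eq; reflexivity. }
  rewrite Cpow_eq; unfold Rpower; auto_derive; [repeat split; exact Hx|].
  simpl; field; lra.
Qed.

Lemma is_derive_Cpow_1 (z : Cplx) (x : R) : 0 < x ->
  is_derive (fun y => Cre (Cpow y z)) x (Cre (Cmul z (Cpow x (Csub z (RtoC 1))))) /\
  is_derive (fun y => Cim (Cpow y z)) x (Cim (Cmul z (Cpow x (Csub z (RtoC 1))))).
Proof.
intros Hx; destruct (is_derive_Cpow (RtoC 1) z x Hx) as [H1 H2].
replace (Cmul (RtoC 1) z) with z in * by ring.
assert (E : forall y, Cmul (RtoC 1) (Cpow y z) = Cpow y z) by (intros y; ring).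
split; [revert H1 | revert H2]; apply is_derive_ext; intros y; rewrite E; reflexivity.
Qed.

Fixpoint csum (a : nat -> Cplx) (N : nat) : Cplx :=
  match N with O => RtoC 0 | S n => Cadd (csum a n) (a n) end.

Lemma csum_psum (a : nat -> Cplx) (N : nat) :
  csum a N = (psum (fun k => Cre (a k)) N, psum (fun k => Cim (a k)) N).
Proof. induction N as [|n IH]; simpl; [reflexivity | rewrite IH; reflexivity]. Qed.

Definition is_limC (u : nat -> Cplx) (l : Cplx) : Prop :=
  is_lim_seq (fun n => Cre (u n)) (Cre l) /\ is_lim_seq (fun n => Cim (u n)) (Cim l).

Lemma is_limC_unique (u : nat -> Cplx) (l m : Cplx) : is_limC u l -> is_limC u m -> l = m.
Proof.
intros [H1 H2] [H3 H4].
apply is_lim_seq_unique in H1, H2, H3, H4.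
apply injective_projections; [rewrite H1 in H3; now injection H3 | rewrite H2 in H4; now injection H4].
Qed.

Lemma is_limC_ext (u v : nat -> Cplx) (l : Cplx) :
  (forall n, u n = v n) -> is_limC u l -> is_limC v l.
Proof.
intros E [H1 H2]; split; [revert H1 | revert H2]; apply is_lim_seq_ext; intros n; rewrite E; reflexivity.
Qed.

Lemma is_limC_minus (u v : nat -> Cplx) (l m : Cplx) :
  is_limC u l -> is_limC v m -> is_limC (fun n => Csub (u n) (v n)) (Csub l m).
Proof. intros [H1 H2] [H3 H4]; split; apply is_lim_seq_minus'; assumption. Qed.

Lemma is_limC_mult_l (c : Cplx) (u : nat -> Cplx) (l : Cplx) :
  is_limC u l -> is_limC (fun n => Cmul c (u n)) (Cmul c l).
Proof.
intros [H1 H2]; split; simpl.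
- apply is_lim_seq_minus'; apply is_lim_seq_mult'; auto using is_lim_seq_const.
- apply is_lim_seq_plus'; apply is_lim_seq_mult'; auto using is_lim_seq_const.
Qed.

(** This is [muntz] at [x = 1] for the function [y^(-s)] and its primitive [y^(1-s) / (1-s)], so its
    convergence is an instance of [muntz_limit]. *)
Definition zeta_partial (s : Cplx) (N : nat) : Cplx :=
  Csub (csum (fun k => Cpow (INR (S k)) (Csub (RtoC 0) s)) N)
       (Cmul (Cinv (Csub (RtoC 1) s)) (Cpow (INR N) (Csub (RtoC 1) s))).

Lemma zeta_partial_converges (s : Cplx) : 0 < Cre s < 1 ->
  exists Z, is_limC (fun n => zeta_partial s (S n)) Z.
Proof.
intros Hs.
set (w := Csub (RtoC 1) s). set (c := Cinv w). set (q := Csub (RtoC 0) s).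
assert (Hw : Cre w ^ 2 + Cim w ^ 2 <> 0).
{ assert (0 < Cre w) by (unfold w; simpl; lra). nra. }
assert (Hcw : Cmul c w = RtoC 1).
{ rewrite <- (Cinv_r w Hw); unfold c; ring. }
assert (Hwq : Csub w (RtoC 1) = q) by (unfold w, q; ring).
set (B := (Rabs (Cre q) + Rabs (Cim q))).
assert (HB : 0 <= B) by (unfold B; pose proof (Rabs_pos (Cre q)); pose proof (Rabs_pos (Cim q)); lra).
assert (Hq : Cre (Csub q (RtoC 1)) = - Cre s - 1) by (unfold q; simpl; ring).
(* [B y^(- Re s - 1)] bounds the derivative of [y^(-s)]; the division is there because
   [controlled_derive] expects the constant multiplied by [p = Re s]. *)
assert (HC : 0 <= B / Cre s) by (apply Rdiv_le_0_compat; lra).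
assert (H1 : controlled (Cre s) (B / Cre s) (fun y => Cre (Cpow y q)) (fun y => Cre (Cmul c (Cpow y w)))).
{ apply (controlled_derive _ _ _ (fun x => Cre (Cmul q (Cpow x (Csub q (RtoC 1)))))); [lra| | |].
  - intros x Hx; destruct (is_derive_Cpow c w x Hx) as [H _].
    rewrite Hcw, Hwq in H. replace (Cpow x q) with (Cmul (RtoC 1) (Cpow x q)) by ring. exact H.
  - intros x Hx; apply is_derive_Cpow_1, Hx.
  - intros x Hx. destruct (Cmul_Cpow_bound q (Csub q (RtoC 1)) x) as [H _].
    eapply Rle_trans; [exact H|]. rewrite Hq; fold B. apply Req_le; field; lra. }
assert (H2 : controlled (Cre s) (B / Cre s) (fun y => Cim (Cpow y q)) (fun y => Cim (Cmul c (Cpow y w)))).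
{ apply (controlled_derive _ _ _ (fun x => Cim (Cmul q (Cpow x (Csub q (RtoC 1)))))); [lra| | |].
  - intros x Hx; destruct (is_derive_Cpow c w x Hx) as [_ H].
    rewrite Hcw, Hwq in H. replace (Cpow x q) with (Cmul (RtoC 1) (Cpow x q)) by ring. exact H.
  - intros x Hx; apply is_derive_Cpow_1, Hx.
  - intros x Hx. destruct (Cmul_Cpow_bound q (Csub q (RtoC 1)) x) as [_ H].
    eapply Rle_trans; [exact H|]. rewrite Hq; fold B. apply Req_le; field; lra. }
apply muntz_limit with (x := 1) in H1; [|lra|exact HC|lra].
apply muntz_limit with (x := 1) in H2; [|lra|exact HC|lra].
eexists (_, _); split; [eapply is_lim_seq_ext; [|apply (proj1 H1)] | eapply is_lim_seq_ext; [|apply (proj1 H2)]].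
- intros n; unfold muntz, zeta_partial; rewrite csum_psum.
  rewrite Rmult_1_r, Rdiv_1_r; unfold Csub at 1; fold w c q.
  change (Cre (?a, ?b)) with a. f_equal. apply psum_ext; intros k _; rewrite Rmult_1_r; reflexivity.
- intros n; unfold muntz, zeta_partial; rewrite csum_psum.
  rewrite Rmult_1_r, Rdiv_1_r; unfold Csub at 1; fold w c q.
  change (Cim (?a, ?b)) with b. f_equal. apply psum_ext; intros k _; rewrite Rmult_1_r; reflexivity.
Qed.

(** Changing the sign of the even terms subtracts them twice, and
    [2 (2 n)^(-s) = 2^(1-s) n^(-s)]. *)
Lemma eta_doubling (s : Cplx) (N : nat) : 
  csum (eta_term s) (2 * N) =
  Csub (csum (fun k => Cpow (INR (S k)) (Csub (RtoC 0) s)) (2 * N))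
    (Cmul (Cpow 2 (Csub (RtoC 1) s)) (csum (fun k => Cpow (INR (S k)) (Csub (RtoC 0) s)) N)).
Proof.
replace (Csub (RtoC 1) s) with (Cadd (RtoC 1) (Csub (RtoC 0) s)) by ring.
rewrite Cpow_add, Cpow_one by lra.
set (q := Csub (RtoC 0) s).
induction N as [|N IH]; [simpl; ring|].
replace (2 * S N)%nat with (S (S (2 * N))) by lia.
assert (E2 : RtoC 2 = Cadd (RtoC 1) (RtoC 1)) by (rewrite <- RtoC_plus; f_equal; ring).
change (csum ?f (S (S (2 * N)))) with (Cadd (Cadd (csum f (2 * N)) (f (2 * N)%nat)) (f (S (2 * N)))).
change (csum ?f (S N)) with (Cadd (csum f N) (f N)).
cbv beta. rewrite IH; unfold eta_term; fold q.
replace ((-1) ^ (2 * N)) with 1 by (rewrite pow_1_even; reflexivity).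
replace ((-1) ^ (S (2 * N))) with (0 - 1) by (rewrite pow_1_odd; ring).
rewrite RtoC_minus.
replace (INR (S (S (2 * N)))) with (2 * INR (S N)) by (rewrite !S_INR, mult_INR; simpl; ring).
rewrite Cpow_base_mult by (try apply INR_S_pos; lra).
rewrite E2; ring.
Qed.

Lemma is_lim_seq_even_odd (u : nat -> R) (l : R) :
  is_lim_seq (fun n => u (2 * n)%nat) l -> is_lim_seq (fun n => u (S (2 * n))) l -> is_lim_seq u l.
Proof.
intros H1 H2; apply is_lim_seq_spec; intros eps.
apply is_lim_seq_spec in H1; apply is_lim_seq_spec in H2.
destruct (H1 eps) as [N1 HN1]; destruct (H2 eps) as [N2 HN2].
exists (2 * (N1 + N2))%nat; intros n Hn.
destruct (Nat.Even_or_Odd n) as [[k ->] | [k ->]].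
- apply HN1; lia.
- replace (2 * k + 1)%nat with (S (2 * k)) by lia. apply HN2; lia.
Qed.

Lemma is_lim_seq_null_of_bound (u : nat -> R) (K r : R) : 0 < r ->
  (forall n, Rabs (u n) <= K * Rpower (INR (S n)) (- r)) -> is_lim_seq u 0.
Proof.
intros Hr H; apply (is_lim_seq_of_bound u 0 K r Hr); intros n; rewrite Rminus_0_r; apply H.
Qed.

Lemma eta_partial_converges (s Z : Cplx) : 0 < Cre s < 1 ->
  is_limC (fun n => zeta_partial s (S n)) Z ->
  has_sum_C (eta_term s) (Cmul (Csub (RtoC 1) (Cpow 2 (Csub (RtoC 1) s))) Z).
Proof.
intros Hs HZ.
set (l := Cmul _ Z).
assert (Heven : is_limC (fun n => csum (eta_term s) (2 * S n)) l).
{ assert (HZ2 : is_limC (fun n => zeta_partial s (2 * S n)) Z).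
  { destruct HZ as [Ha Hb].
    split; [apply (is_lim_seq_subseq (fun n => Cre (zeta_partial s (S n))) _ (fun n => S (2 * n))) in Ha
           |apply (is_lim_seq_subseq (fun n => Cim (zeta_partial s (S n))) _ (fun n => S (2 * n))) in Hb].
    - revert Ha; apply is_lim_seq_ext; intros n; do 2 f_equal; lia.
    - apply eventually_subseq; intros n; lia.
    - revert Hb; apply is_lim_seq_ext; intros n; do 2 f_equal; lia.
    - apply eventually_subseq; intros n; lia. }
  replace l with (Csub Z (Cmul (Cpow 2 (Csub (RtoC 1) s)) Z)) by (unfold l; ring).
  (* In [zeta_partial s (2 N) - 2^(1-s) zeta_partial s N] the corrections cancel, since
     [(2 N)^(1-s) = 2^(1-s) N^(1-s)]; the alternating sum remains. *)
  eapply is_limC_ext; [|apply is_limC_minus; [exact HZ2 | apply is_limC_mult_l, HZ]].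
  intros n; cbv beta. rewrite eta_doubling; unfold zeta_partial.
  replace (INR (2 * S n)) with (2 * INR (S n)) by (rewrite mult_INR; simpl; ring).
  rewrite Cpow_base_mult by (try apply INR_S_pos; lra). ring. }
assert (Hterm : forall n, Rabs (Cre (eta_term s n)) <= 1 * Rpower (INR (S n)) (- Cre s) /\
                          Rabs (Cim (eta_term s n)) <= 1 * Rpower (INR (S n)) (- Cre s)).
{ intros n; unfold eta_term.
  destruct (Cmul_Cpow_bound (RtoC ((-1) ^ n)) (Csub (RtoC 0) s) (INR (S n))) as [H1 H2].
  change (Cre (RtoC ((-1) ^ n))) with ((-1) ^ n) in H1, H2. change (Cim (RtoC ((-1) ^ n))) with 0 in H1, H2.
  rewrite pow_1_abs, Rabs_R0, Rplus_0_r in H1, H2.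
  replace (Cre (Csub (RtoC 0) s)) with (- Cre s) in H1, H2 by (simpl; ring). split; assumption. }
(* Odd partial sums differ from even ones by a single term, which tends to 0. Here [pr] stands for
   the real or the imaginary part. *)
assert (Hfin : forall pr : Cplx -> R, (forall a b, pr (Cadd a b) = pr a + pr b) ->
  is_lim_seq (fun n => pr (csum (eta_term s) (2 * S n))) (pr l) ->
  is_lim_seq (fun n => pr (eta_term s n)) 0 ->
  is_lim_seq (fun n => pr (csum (eta_term s) n)) (pr l)).
{ intros pr Hpr He Ht.
  apply (is_lim_seq_incr_1 (fun n => pr (csum (eta_term s) (2 * n)))) in He.
  apply is_lim_seq_even_odd; [exact He|].
  apply (is_lim_seq_ext (fun n => pr (csum (eta_term s) (2 * n)) + pr (eta_term s (2 * n)))).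
  { intros n; rewrite <- Hpr; reflexivity. }
  rewrite <- (Rplus_0_r (pr l)).
  apply is_lim_seq_plus'; [exact He|].
  apply (is_lim_seq_subseq (fun n => pr (eta_term s n)) 0 (fun n => (2 * n)%nat)); [|exact Ht].
  apply eventually_subseq; intros n; lia. }
split; unfold infinite_sum.
- assert (H : is_lim_seq (fun n => Cre (csum (eta_term s) n)) (Cre l)).
  { apply Hfin; [reflexivity | apply Heven|].
    apply (is_lim_seq_null_of_bound _ 1 (Cre s)); [lra | intros n; apply Hterm]. }
  apply (is_lim_seq_incr_1 (fun n => Cre (csum (eta_term s) n))) in H.
  apply is_lim_seq_Reals. revert H; apply is_lim_seq_ext; intros n.
  rewrite csum_psum, psum_sum_f_R0; reflexivity.
- assert (H : is_lim_seq (fun n => Cim (csum (eta_term s) n)) (Cim l)).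
  { apply Hfin; [reflexivity | apply Heven|].
    apply (is_lim_seq_null_of_bound _ 1 (Cre s)); [lra | intros n; apply Hterm]. }
  apply (is_lim_seq_incr_1 (fun n => Cim (csum (eta_term s) n))) in H.
  apply is_lim_seq_Reals. revert H; apply is_lim_seq_ext; intros n.
  rewrite csum_psum, psum_sum_f_R0; reflexivity.
Qed.

Lemma has_sum_C_unique (a : nat -> Cplx) (l m : Cplx) : has_sum_C a l -> has_sum_C a m -> l = m.
Proof.
intros [H1 H2] [H3 H4]; apply injective_projections; eapply uniqueness_sum; eassumption.
Qed.

(** The modulus of [2^(1-s)] is [P = 2^(1 - Re s) > 1], so the squared modulus of the factor is at
    least [(P - 1)^2]. *)
Lemma eta_factor_neq_0 (s : Cplx) : Cre s < 1 ->
  let w := Csub (RtoC 1) (Cpow 2 (Csub (RtoC 1) s)) in Cre w ^ 2 + Cim w ^ 2 <> 0.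
Proof.
intros Hs w; unfold w; rewrite Cpow_eq; simpl.
set (th := (0 - Cim s) * ln 2).
assert (HP : 1 < Rpower 2 (1 - Cre s)).
{ rewrite <- (Rpower_O 2) at 1 by lra. apply Rpower_lt; lra. }
set (P := Rpower 2 (1 - Cre s)) in *.
pose proof (sin2_cos2 th) as E; unfold Rsqr in E.
pose proof (COS_bound th).
assert (P * cos th <= P * 1) by (apply Rmult_le_compat_l; lra).
assert (0 < (1 - P * cos th) * (1 - P * cos th) + (P * sin th) * (P * sin th)).
{ replace (_ + _) with (1 - 2 * (P * cos th) + P * P * (sin th * sin th + cos th * cos th)) by ring.
  rewrite E; nra. }
nra.
Qed.

(** [zeta s] is a chosen solution [z] of an equation with the eta series on one side. The limit of
    [zeta_partial] is another solution, and the two agree because the factor in front of [z] is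
    invertible. *)
Lemma zeta_limit (s : Cplx) : 0 < Cre s < 1 ->
  is_limC (fun n => zeta_partial s (S n)) (zeta s).
Proof.
intros Hs; destruct (zeta_partial_converges s Hs) as [Z HZ].
replace (zeta s) with Z; [exact HZ|].
pose proof (eta_partial_converges s Z Hs HZ) as HS.
assert (HS' : has_sum_C (eta_term s) (Cmul (Csub (RtoC 1) (Cpow 2 (Csub (RtoC 1) s))) (zeta s))).
{ unfold zeta; apply epsilon_spec with (P := fun z => has_sum_C (eta_term s) (Cmul _ z)).
  exists Z; exact HS. }
pose proof (has_sum_C_unique _ _ _ HS HS') as E.
pose proof (eta_factor_neq_0 s (proj2 Hs)) as Hw; cbv zeta in Hw.
revert E Hw; generalize (Csub (RtoC 1) (Cpow 2 (Csub (RtoC 1) s))); intros w E Hw.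
apply Cinv_r in Hw.
transitivity (Cmul (Cmul w (Cinv w)) Z); [rewrite Hw; ring|].
transitivity (Cmul (Cinv w) (Cmul w Z)); [ring|].
rewrite E. transitivity (Cmul (Cmul w (Cinv w)) (zeta s)); [ring|]. rewrite Hw; ring.
Qed.

(** * Muntz's formula *)

(** The boundary terms of an integration by parts: both vanish when [B] has opposite power bounds at
    the two ends. *)
Lemma Improper_derivative (B b : R -> R) (K e : R) : 0 < e ->
  (forall x, 0 < x -> is_derive B x (b x)) -> (forall x, 0 < x -> continuous b x) ->
  (forall x, 0 < x -> Rabs (B x) <= K * Rpower x e /\ Rabs (B x) <= K * Rpower x (- e)) ->
  Improper b 0.
Proof.
intros He HB Hb HK; split; [exact Hb|].
exists B; split; [exact HB | split].
- apply (lim_zero_of_bound B 0 K e He); intros x Hx; rewrite Rminus_0_r; apply HK, Hx.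
- apply (lim_infty_of_bound B 0 K e He); intros x Hx; rewrite Rminus_0_r; apply HK, Hx.
Qed.

Lemma continuous_Cpow (z : Cplx) (x : R) : 0 < x ->
  continuous (fun y => Cre (Cpow y z)) x /\ continuous (fun y => Cim (Cpow y z)) x.
Proof.
intros Hx; destruct (is_derive_Cpow_1 z x Hx) as [H1 H2].
split; [apply (ex_derive_continuous (fun y => Cre (Cpow y z))) |
  apply (ex_derive_continuous (fun y => Cim (Cpow y z)))]; eexists; eassumption.
Qed.

Lemma Cre_real_mult (r : R) (z : Cplx) : Cre (Cmul (RtoC r) z) = r * Cre z.
Proof. simpl; ring. Qed.

Lemma Cim_real_mult (r : R) (z : Cplx) : Cim (Cmul (RtoC r) z) = r * Cim z.
Proof. simpl; ring. Qed.

Lemma mult_power_bound (a b A B x u v w : R) : w = u + v ->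
  Rabs a <= A * Rpower x u -> Rabs b <= B * Rpower x v -> Rabs (a * b) <= A * B * Rpower x w.
Proof.
intros -> Ha Hb; rewrite Rabs_mult, Rpower_plus.
replace (A * B * (Rpower x u * Rpower x v)) with ((A * Rpower x u) * (B * Rpower x v)) by ring.
apply Rmult_le_compat; auto using Rabs_pos.
Qed.

Section Mellin.

Variables (e C : R) (s : Cplx) (g G : R -> R).
Hypothesis (He : 0 < e) (Hs0 : 0 < Cre s - e) (Hs1 : Cre s + e < 1).
Hypothesis Hm : admissible (Cre s - e) C g G.
Hypothesis Hp : admissible (Cre s + e) C g G.

Let q := Csub s (RtoC 1).
Let k (x : R) := Cpow x q.

Let HC : 0 <= C := admissible_const_pos _ _ _ _ Hm.

(** The kernel has size [x^(Re s - 1)], so bounds with exponents [e] below and above [Re s] become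
    exactly the two bounds of [tame]. The result is linear in [K], which may later depend on [n]. *)
Lemma Mellin_kernel_tame (K : R) (h : R -> R) :
  (forall x, 0 < x -> continuous h x) ->
  (forall x, 0 < x -> Rabs (h x) <= K * Rpower x (- (Cre s - e)) /\
                      Rabs (h x) <= K * Rpower x (- (Cre s + e))) ->
  exists l, ImproperC (fun x => Cmul (RtoC (h x)) (k x)) l /\
    Rabs (Cre l) <= 2 * (K / e) /\ Rabs (Cim l) <= 2 * (K / e).
Proof.
intros Hc Hb.
assert (Hq : Cre q = Cre s - 1) by (unfold q; simpl; ring).
assert (Hk : forall x, Rabs (Cre (k x)) <= 1 * Rpower x (Cre s - 1) /\
                       Rabs (Cim (k x)) <= 1 * Rpower x (Cre s - 1)).
{ intros x; rewrite Rmult_1_l, <- Hq; apply Cpow_bound. }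
destruct (tame_Improper e K (fun x => h x * Cre (k x)) He) as [l1 [H1 B1]].
{ split; intros x Hx.
  - apply (continuous_mult h (fun y => Cre (k y))); [apply Hc, Hx | apply (proj1 (continuous_Cpow q x Hx))].
  - rewrite <- (Rmult_1_r K); destruct (Hb x Hx) as [A1 A2], (Hk x) as [K1 K2].
    split; [eapply mult_power_bound; [|exact A1|exact K1]; ring
           |eapply mult_power_bound; [|exact A2|exact K1]; ring]. }
destruct (tame_Improper e K (fun x => h x * Cim (k x)) He) as [l2 [H2 B2]].
{ split; intros x Hx.
  - apply (continuous_mult h (fun y => Cim (k y))); [apply Hc, Hx | apply (proj2 (continuous_Cpow q x Hx))].
  - rewrite <- (Rmult_1_r K); destruct (Hb x Hx) as [A1 A2], (Hk x) as [K1 K2].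
    split; [eapply mult_power_bound; [|exact A1|exact K2]; ring
           |eapply mult_power_bound; [|exact A2|exact K2]; ring]. }
exists (l1, l2); split; [split | split; assumption].
- revert H1; apply Improper_ext; intros; symmetry; apply Cre_real_mult.
- revert H2; apply Improper_ext; intros; symmetry; apply Cim_real_mult.
Qed.

(* Integration by parts avoids Fubini's theorem here. *)
Lemma Mellin_primitive (l : Cplx) :
  ImproperC (fun x => Cmul (RtoC (g x)) (k x)) l ->
  ImproperC (fun x => Cmul (RtoC (G x / x)) (k x)) (Cmul (Cinv (Csub (RtoC 1) s)) l).
Proof.
intros Hl.
assert (Hq : Cre q = Cre s - 1) by (unfold q; simpl; ring).
assert (Hcg : forall x, 0 < x -> continuous g x)
  by (intros; apply (controlled_continuous (Cre s - e) C g G); [apply Hm | assumption]).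
assert (HcG : forall x, 0 < x -> continuous G x).
{ intros x Hx; apply (ex_derive_continuous G); eexists; apply Hm, Hx. }
assert (Hci : forall x, 0 < x -> continuous Rinv x)
  by (intros; apply (ex_derive_continuous Rinv); auto_derive; lra).
assert (Hk : forall x, Rabs (Cre (k x)) <= 1 * Rpower x (Cre s - 1) /\
                       Rabs (Cim (k x)) <= 1 * Rpower x (Cre s - 1)).
{ intros x; rewrite Rmult_1_l, <- Hq; apply Cpow_bound. }
assert (Hd : forall x, 0 < x ->
  is_derive (fun y => Cre (k y)) x (Cre (Cmul q (Cmul (RtoC (/ x)) (k x)))) /\
  is_derive (fun y => Cim (k y)) x (Cim (Cmul q (Cmul (RtoC (/ x)) (k x))))).
{ intros x Hx; unfold k; rewrite <- Cpow_sub_one by exact Hx; apply is_derive_Cpow_1, Hx. }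
assert (HGb : forall x, 0 < x -> Rabs (G x) <= C * Rpower x (1 - (Cre s - e)) /\
                                 Rabs (G x) <= C * Rpower x (1 - (Cre s + e)))
  by (intros; split; [apply Hm | apply Hp]; assumption).
(* The integrand is [(G k)'], because [k' = q k / x]. The product [G k] is [O(x^e)] at 0 and
   [O(x^(-e))] at infinity. *)
assert (H0 : ImproperC (fun x => Cadd (Cmul (RtoC (g x)) (k x))
    (Cmul q (Cmul (RtoC (G x / x)) (k x)))) (RtoC 0)).
{ split.
  - apply (Improper_derivative (fun x => G x * Cre (k x)) _ (C * 1) e He).
    + intros x Hx.
      replace (Cre _) with (g x * Cre (k x) + G x * Cre (Cmul q (Cmul (RtoC (/ x)) (k x))))
        by (simpl; field; lra).
      apply (is_derive_mult G (fun y => Cre (k y))); [apply Hm, Hx | apply Hd, Hx | apply Rmult_comm].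
    + intros x Hx. destruct (continuous_Cpow q x Hx) as [K1 K2].
      apply (continuous_ext (fun x => g x * Cre (k x) + G x * / x * (Cre q * Cre (k x) - Cim q * Cim (k x)))).
      { intros y; R_eq; simpl; unfold Rdiv; ring. }
      apply (continuous_plus (fun x => g x * Cre (k x)) (fun x => G x * / x * (Cre q * Cre (k x) - Cim q * Cim (k x)))).
      * apply (continuous_mult g (fun x => Cre (k x))); auto.
      * apply (continuous_mult (fun x => G x * / x) (fun x => Cre q * Cre (k x) - Cim q * Cim (k x))).
        -- apply (continuous_mult G Rinv); auto.
        -- apply (continuous_minus (fun x => Cre q * Cre (k x)) (fun x => Cim q * Cim (k x)));
             [apply (continuous_scal_r (Cre q) (fun x => Cre (k x))) |
              apply (continuous_scal_r (Cim q) (fun x => Cim (k x)))]; assumption.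
    + intros x Hx; destruct (HGb x Hx) as [A1 A2], (Hk x) as [K1 K2].
      split; [eapply mult_power_bound; [|exact A1|exact K1]; ring
             |eapply mult_power_bound; [|exact A2|exact K1]; ring].
  - apply (Improper_derivative (fun x => G x * Cim (k x)) _ (C * 1) e He).
    + intros x Hx.
      replace (Cim _) with (g x * Cim (k x) + G x * Cim (Cmul q (Cmul (RtoC (/ x)) (k x))))
        by (simpl; field; lra).
      apply (is_derive_mult G (fun y => Cim (k y))); [apply Hm, Hx | apply Hd, Hx | apply Rmult_comm].
    + intros x Hx. destruct (continuous_Cpow q x Hx) as [K1 K2].
      apply (continuous_ext (fun x => g x * Cim (k x) + G x * / x * (Cre q * Cim (k x) + Cim q * Cre (k x)))).
      { intros y; R_eq; simpl; unfold Rdiv; ring. }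
      apply (continuous_plus (fun x => g x * Cim (k x)) (fun x => G x * / x * (Cre q * Cim (k x) + Cim q * Cre (k x)))).
      * apply (continuous_mult g (fun x => Cim (k x))); auto.
      * apply (continuous_mult (fun x => G x * / x) (fun x => Cre q * Cim (k x) + Cim q * Cre (k x))).
        -- apply (continuous_mult G Rinv); auto.
        -- apply (continuous_plus (fun x => Cre q * Cim (k x)) (fun x => Cim q * Cre (k x)));
             [apply (continuous_scal_r (Cre q) (fun x => Cim (k x))) |
              apply (continuous_scal_r (Cim q) (fun x => Cre (k x)))]; assumption.
    + intros x Hx; destruct (HGb x Hx) as [A1 A2], (Hk x) as [K1 K2].
      split; [eapply mult_power_bound; [|exact A1|exact K2]; ring
             |eapply mult_power_bound; [|exact A2|exact K2]; ring]. }
assert (Hw : Cmul (Csub (RtoC 1) s) (Cinv (Csub (RtoC 1) s)) = RtoC 1).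
{ apply Cinv_r. assert (0 < Cre (Csub (RtoC 1) s)) by (simpl; lra). nra. }
set (c := Cinv (Csub (RtoC 1) s)) in *.
(* Removing the integral of [g k] leaves [q] times the wanted integral; since [q = s - 1], the
   multiplier [-c] is [1 / q]. *)
pose proof (ImproperC_mult (Csub (RtoC 0) c) _ _
  (ImproperC_plus _ _ _ _ H0 (ImproperC_mult (Csub (RtoC 0) (RtoC 1)) _ _ Hl))) as H.
replace (Cmul c l) with (Cmul (Csub (RtoC 0) c) (Cadd (RtoC 0) (Cmul (Csub (RtoC 0) (RtoC 1)) l))) by ring.
revert H; apply ImproperC_ext; intros x Hx.
transitivity (Cmul (Cmul (Csub (RtoC 1) s) c) (Cmul (RtoC (G x / x)) (k x))).
- unfold q; ring.
- rewrite Hw; ring.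
Qed.

Lemma Mellin_dilate (h : R -> R) (l : Cplx) (n : nat) :
  ImproperC (fun x => Cmul (RtoC (h x)) (k x)) l ->
  ImproperC (fun x => Cmul (RtoC (h (INR (S n) * x))) (k x))
    (Cmul (Cpow (INR (S n)) (Csub (RtoC 0) s)) l).
Proof.
intros Hl; pose proof (INR_S_pos n) as Hn.
(* Dilation also affects the kernel, by a factor [n^(s-1)]. The multiplier [n^(1-s)] undoes this
   and, with the [1 / n] of the substitution, leaves [n^(-s)]; in the code [n] is [S n]. *)
pose proof (ImproperC_mult (Cpow (INR (S n)) (Csub (RtoC 1) s)) _ _
  (ImproperC_dilate (INR (S n)) _ _ Hn Hl)) as H.
replace (Cmul (Cpow (INR (S n)) (Csub (RtoC 0) s)) l) with
  (Cmul (Cpow (INR (S n)) (Csub (RtoC 1) s)) (Cmul (RtoC (/ INR (S n))) l)).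
2:{ replace (Csub (RtoC 0) s) with (Csub (Csub (RtoC 1) s) (RtoC 1)) by ring.
    rewrite Cpow_sub_one by exact Hn. ring. }
revert H; apply ImproperC_ext; intros x Hx; unfold k; rewrite Cpow_base_mult by assumption.
transitivity (Cmul (Cpow (INR (S n)) (Cadd (Csub (RtoC 1) s) q))
  (Cmul (RtoC (h (INR (S n) * x))) (Cpow x q))).
- rewrite Cpow_add; ring.
- replace (Cadd (Csub (RtoC 1) s) q) with (RtoC 0) by (unfold q; ring). rewrite Cpow_zero; ring.
Qed.

Lemma ImproperC_csum (h : nat -> R -> R) (c : nat -> Cplx) (l : Cplx) (N : nat) :
  (forall n, ImproperC (fun x => Cmul (RtoC (h n x)) (k x)) (Cmul (c n) l)) ->
  (0 < N)%nat ->
  ImproperC (fun x => Cmul (RtoC (psum (fun n => h n x) N)) (k x)) (Cmul (csum c N) l).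
Proof.
intros H HN; induction HN as [|N HN IH].
- simpl csum; replace (Cmul (Cadd (RtoC 0) (c 0%nat)) l) with (Cmul (c 0%nat) l) by ring.
  generalize (H 0%nat); apply ImproperC_ext; intros x Hx; simpl psum; rewrite Rplus_0_l; reflexivity.
- simpl csum; replace (Cmul (Cadd (csum c N) (c N)) l) with (Cadd (Cmul (csum c N) l) (Cmul (c N) l)) by ring.
  generalize (ImproperC_plus _ _ _ _ IH (H N)); apply ImproperC_ext; intros x Hx; simpl psum.
  rewrite RtoC_plus; ring.
Qed.

Lemma Mellin_muntz (l : Cplx) (n : nat) :
  ImproperC (fun x => Cmul (RtoC (g x)) (k x)) l ->
  ImproperC (fun x => Cmul (RtoC (muntz g G (S n) x)) (k x)) (Cmul (zeta_partial s (S n)) l).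
Proof.
intros Hl.
pose proof (ImproperC_csum (fun n x => g (INR (S n) * x)) _ l (S n)
  (fun n => Mellin_dilate g l n Hl) ltac:(lia)) as H1.
(* The integral term of [muntz] is [G (N x) / x = N (G (N x) / (N x))], that is, [N] times a dilate
   of [G x / x]. *)
pose proof (Mellin_dilate (fun x => G x / x) _ n (Mellin_primitive l Hl)) as H2.
apply ImproperC_mult with (c := RtoC (0 - INR (S n))) in H2.
pose proof (ImproperC_plus _ _ _ _ H1 H2) as H3.
assert (E : Cpow (INR (S n)) (Csub (RtoC 1) s) =
  Cmul (RtoC (INR (S n))) (Cpow (INR (S n)) (Csub (RtoC 0) s))).
{ rewrite <- (Cpow_one (INR (S n))) by apply INR_S_pos. rewrite <- Cpow_add. f_equal; ring. }
unfold zeta_partial; rewrite E.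
replace (Cmul (Csub _ _) l) with (Cadd
  (Cmul (csum (fun n => Cpow (INR (S n)) (Csub (RtoC 0) s)) (S n)) l)
  (Cmul (RtoC (0 - INR (S n))) (Cmul (Cpow (INR (S n)) (Csub (RtoC 0) s)) (Cmul (Cinv (Csub (RtoC 1) s)) l))))
  by (rewrite RtoC_minus; ring).
revert H3; apply ImproperC_ext; intros x Hx.
pose proof (INR_S_pos n).
transitivity (Cmul (RtoC (psum (fun k => g (INR (S k) * x)) (S n)
  + (0 - INR (S n)) * (G (INR (S n) * x) / (INR (S n) * x)))) (k x)).
- rewrite RtoC_plus, RtoC_mult; ring.
- do 2 f_equal; unfold muntz; field; lra.
Qed.

(** The numbers [zeta_partial s N * l] have two limits to compare: the transform of [muntz_lim g G],
    by a uniform estimate of the error, and [zeta s * l], by [zeta_limit]. *)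
Theorem muntz_formula (l : Cplx) :
  ImproperC (fun x => Cmul (RtoC (g x)) (k x)) l ->
  ImproperC (fun x => Cmul (RtoC (muntz_lim g G x)) (k x)) (Cmul (zeta s) l).
Proof.
intros Hl.
pose (M := muntz_lim g G).
assert (HMc : forall x, 0 < x -> continuous M x).
{ intros x Hx; apply (muntz_lim_continuous (Cre s - e) C); [exact Hs0 | exact HC | apply Hm | exact Hx]. }
destruct (Mellin_kernel_tame (3 * C) M HMc) as [m [Hmm _]].
{ intros x Hx; split; rewrite <- (Rminus_0_r (M x)); unfold M.
  - apply is_lim_seq_Rabs_le with (u := fun n => muntz g G (S n) x).
    + apply (muntz_limit (Cre s - e) C); [exact Hs0 | exact HC | apply Hm | exact Hx].
    + intros n; rewrite Rminus_0_r; apply muntz_bound; assumption.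
  - apply is_lim_seq_Rabs_le with (u := fun n => muntz g G (S n) x).
    + apply (muntz_limit (Cre s - e) C); [exact Hs0 | exact HC | apply Hm | exact Hx].
    + intros n; rewrite Rminus_0_r; apply muntz_bound; [lra | assumption..]. }
replace (Cmul (zeta s) l) with m; [exact Hmm|].
assert (Hrate : forall n,
  Rabs (Cre (Cmul (zeta_partial s (S n)) l) - Cre m) <= 2 * (C / e) * Rpower (INR (S n)) (- (Cre s - e)) /\
  Rabs (Cim (Cmul (zeta_partial s (S n)) l) - Cim m) <= 2 * (C / e) * Rpower (INR (S n)) (- (Cre s - e))).
{ intros n.
  (* With a constant that decays in [n], the bound on the integral turns the pointwise rate into a
     rate for the transforms. *)
  destruct (Mellin_kernel_tame (C * Rpower (INR (S n)) (- (Cre s - e)))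
    (fun x => muntz g G (S n) x - M x)) as [d [Hd Hdb]].
  - intros x Hx; apply (continuous_minus (muntz g G (S n)) M); [|apply HMc, Hx].
    apply (muntz_continuous (Cre s - e) C); [apply Hm | exact Hx].
  - intros x Hx.
    destruct (muntz_limit (Cre s - e) C g G x Hs0 HC (proj1 Hm) Hx) as [_ R1].
    destruct (muntz_limit (Cre s + e) C g G x ltac:(lra) HC (proj1 Hp) Hx) as [_ R2].
    specialize (R1 n); specialize (R2 n); split.
    + eapply Rle_trans; [exact R1 | apply Req_le; ring].
    (* The larger exponent gives the faster rate in [n]; it is relaxed to the slower one so that
       both bounds share a constant. *)
    + eapply Rle_trans; [exact R2|].
      replace (C * Rpower (INR (S n)) (- (Cre s - e)) * Rpower x (- (Cre s + e)))
        with (C * Rpower x (- (Cre s + e)) * Rpower (INR (S n)) (- (Cre s - e))) by ring.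
      apply Rmult_le_compat_l; [apply Rmult_le_pos; [exact HC | left; apply Rpower_pos]|].
      apply Rle_Rpower; [|lra]. rewrite S_INR; pose proof (pos_INR n); lra.
  - assert (E : d = Csub (Cmul (zeta_partial s (S n)) l) m).
    { apply (ImproperC_unique _ _ _ Hd).
      replace (Csub (Cmul (zeta_partial s (S n)) l) m) with
        (Cadd (Cmul (zeta_partial s (S n)) l) (Cmul (Csub (RtoC 0) (RtoC 1)) m)) by ring.
      generalize (ImproperC_plus _ _ _ _ (Mellin_muntz l n Hl) (ImproperC_mult (Csub (RtoC 0) (RtoC 1)) _ _ Hmm)).
      apply ImproperC_ext; intros x Hx; rewrite RtoC_minus; ring. }
    rewrite E in Hdb.
    replace (2 * (C / e) * Rpower (INR (S n)) (- (Cre s - e)))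
      with (2 * (C * Rpower (INR (S n)) (- (Cre s - e)) / e)) by (field; lra).
    exact Hdb. }
assert (L1 : is_limC (fun n => Cmul (zeta_partial s (S n)) l) m).
{ split; apply (is_lim_seq_of_bound _ _ (2 * (C / e)) (Cre s - e) Hs0); intros n; apply Hrate. }
apply (is_limC_unique _ _ _ L1).
apply (is_limC_ext (fun n => Cmul l (zeta_partial s (S n)))); [intros; ring|].
replace (Cmul (zeta s) l) with (Cmul l (zeta s)) by ring.
apply is_limC_mult_l, zeta_limit; lra.
Qed.

End Mellin.

(** * Iterating on the class M_alpha *)

Lemma admissible_weaken (p C K : R) (g G : R -> R) : 0 < p -> C <= K ->
  admissible p C g G -> admissible p K g G.
Proof.
intros Hp HCK [[HG Hv] [Hb HB]]; split; [split; [exact HG|]|split].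
- intros w v Hwv; eapply Rle_trans; [apply Hv, Hwv|].
  apply Rmult_le_compat_r; [|exact HCK].
  pose proof (Rpower_ge_base w v (- p)); lra.
- intros x Hx; eapply Rle_trans; [apply Hb, Hx|].
  apply Rmult_le_compat_r; [left; apply Rpower_pos | exact HCK].
- intros x Hx; eapply Rle_trans; [apply HB, Hx|].
  apply Rmult_le_compat_r; [left; apply Rpower_pos | exact HCK].
Qed.

Lemma Rpower_div_base (x r : R) : 0 < x -> Rpower x r / x = Rpower x (r - 1).
Proof.
intros Hx; unfold Rminus; rewrite Rpower_plus, Rpower_Ropp, Rpower_1 by exact Hx; reflexivity.
Qed.

Lemma Rpower_mul_base (x r : R) : 0 < x -> x * Rpower x r = Rpower x (1 + r).
Proof. intros Hx; rewrite Rpower_plus, Rpower_1 by exact Hx; reflexivity. Qed.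

Lemma lim_zero_minus (A B : R -> R) (l m : R) :
  lim_zero A l -> lim_zero B m -> lim_zero (fun x => A x - B x) (l - m).
Proof.
intros HA HB; apply lim_zero_spec; intros eps He.
destruct (proj1 (lim_zero_spec A l) HA (eps / 2) ltac:(lra)) as [d [Hd H1]].
destruct (proj1 (lim_zero_spec B m) HB (eps / 2) ltac:(lra)) as [d' [Hd' H2]].
exists (Rmin d d'); split; [apply Rmin_glb_lt; assumption|]; intros x Hx.
pose proof (Rmin_l d d'); pose proof (Rmin_r d d').
specialize (H1 x ltac:(lra)); specialize (H2 x ltac:(lra)).
replace (A x - B x - (l - m)) with ((A x - l) - (B x - m)) by ring.
eapply Rle_lt_trans; [apply Rabs_triang|]. rewrite Rabs_Ropp; lra.
Qed.

(* The primitive of [muntz f Phi N] that vanishes at 0, when [Phi' = f] and [Psi' x = Phi x / x]. *)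
Definition muntz_prim (Phi Psi : R -> R) (N : nat) (x : R) : R :=
  psum (fun k => Phi (INR (S k) * x) / INR (S k)) N - Psi (INR N * x).

(* The class M_alpha in the form used below, with [alpha = 1 + 4 e]. *)
Definition regular (e C : R) (f f1 f2 : R -> R) : Prop :=
  (forall x, 0 < x -> is_derive f x (f1 x)) /\
  (forall x, 0 < x -> is_derive f1 x (f2 x)) /\
  forall x r, 0 < x ->
    (0 <= r <= 1 + 4 * e -> Rabs (f x) <= C * Rpower x (- r)) /\
    (0 <= r <= 2 + 4 * e -> Rabs (f1 x) <= C * Rpower x (- r)) /\
    (0 <= r <= 3 + 4 * e -> Rabs (f2 x) <= C * Rpower x (- r)).

Section Regular.

Variables (e C : R) (f f1 f2 Phi Psi : R -> R).
Hypothesis (He : 0 < e <= 1 / 8) (Hf : regular e C f f1 f2).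
Hypothesis HPhi : forall x, 0 < x -> is_derive Phi x (f x).
Hypothesis HPhi0 : lim_zero Phi 0.
Hypothesis HPsi : forall x, 0 < x -> is_derive Psi x (Phi x / x).
Hypothesis HPsi0 : lim_zero Psi 0.

Lemma regular_const_pos : 0 <= C.
Proof.
destruct Hf as [_ [_ H]]; destruct (H 1 0 Rlt_0_1) as [H1 _].
specialize (H1 ltac:(lra)).
pose proof (Rabs_pos (f 1)); pose proof (Rpower_pos 1 (- 0)); nra.
Qed.

Lemma f_bound (x r : R) : 0 < x -> 0 <= r <= 1 + 4 * e -> Rabs (f x) <= C * Rpower x (- r).
Proof. intros Hx Hr; apply Hf; assumption. Qed.

Lemma Phi_bound (p x : R) : 0 <= p < 1 -> 0 < x -> Rabs (Phi x) <= C / (1 - p) * Rpower x (1 - p).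
Proof.
intros Hp Hx; apply (antiderivative_bound Phi f C (1 - p)); auto; [lra|].
intros y Hy; replace (1 - p - 1) with (- p) by ring; apply f_bound; [exact Hy | lra].
Qed.

Lemma Psi_bound (p x : R) : 0 <= p < 1 -> 0 < x ->
  Rabs (Psi x) <= C / (1 - p) / (1 - p) * Rpower x (1 - p).
Proof.
intros Hp Hx; apply (antiderivative_bound Psi (fun x => Phi x / x)); auto; [lra|].
intros y Hy; rewrite Rabs_div, (Rabs_pos_eq y) by lra.
apply Rle_div_l; [lra|].
replace (C / (1 - p) * Rpower y (1 - p - 1) * y) with (C / (1 - p) * (y * Rpower y (1 - p - 1))) by ring.
rewrite Rpower_mul_base by exact Hy.
replace (1 + (1 - p - 1)) with (1 - p) by ring. apply Phi_bound; assumption.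
Qed.

(** In the constant, [/ p] pays for the increments, 1 for the size of [f] and [/ (1 - p)] for that
    of [Phi]. *)
Lemma regular_admissible (p : R) : 0 < p < 1 ->
  admissible p (C * (1 + / p + / (1 - p))) f Phi.
Proof.
intros Hp; pose proof regular_const_pos as HC.
assert (0 < / p) by (apply Rinv_0_lt_compat; lra).
assert (0 < / (1 - p)) by (apply Rinv_0_lt_compat; lra).
split; [|split].
- apply (controlled_derive p _ f f1 Phi); [lra | exact HPhi | apply Hf|].
  intros x Hx; eapply Rle_trans; [apply Hf with (r := p + 1); [exact Hx | lra]|].
  replace (- (p + 1)) with (- p - 1) by ring.
  apply Rmult_le_compat_r; [left; apply Rpower_pos|].
  replace (C * (1 + / p + / (1 - p)) * p) with (C * 1 + C * (p + / (1 - p) * p)) by (field; lra).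
  assert (0 <= C * (p + / (1 - p) * p)) by (apply Rmult_le_pos; [lra | nra]). lra.
- intros x Hx; eapply Rle_trans; [apply f_bound with (r := p); [exact Hx | lra]|].
  apply Rmult_le_compat_r; [left; apply Rpower_pos | nra].
- intros x Hx; eapply Rle_trans; [apply Phi_bound with (p := p); [lra | exact Hx]|].
  apply Rmult_le_compat_r; [left; apply Rpower_pos | unfold Rdiv; nra].
Qed.

(* [x * (muntz f Phi N)' x] is again a [muntz] sum, for the function [x f'(x)]. *)
Let h (x : R) := x * f1 x.
Let H (x : R) := x * f x - Phi x.

(** The second derivative enters here, through [h' = f1 + x f2]; the two terms give the numerator of
    [2 / p]. Integration by parts makes [H] the primitive of [h] that vanishes at 0. *)
Lemma regular_euler_admissible (p : R) : 0 < p < 1 ->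
  admissible p (C * (1 + 2 / p + / (1 - p))) h H.
Proof.
intros Hp; pose proof regular_const_pos as HC.
assert (0 < / p) by (apply Rinv_0_lt_compat; lra).
assert (0 < / (1 - p)) by (apply Rinv_0_lt_compat; lra).
split; [|split].
- apply (controlled_derive p _ h (fun x => f1 x + x * f2 x) H); [lra | | |].
  + intros x Hx.
    replace (h x) with ((1 * f x + x * f1 x) - f x) by (unfold h; ring).
    apply (is_derive_minus (fun x => x * f x) Phi); [|apply HPhi, Hx].
    apply (is_derive_mult (fun x => x) f x 1 (f1 x)); [apply (is_derive_id x) | apply Hf, Hx | apply Rmult_comm].
  + intros x Hx.
    replace (f1 x + x * f2 x) with (1 * f1 x + x * f2 x) by ring.
    apply (is_derive_mult (fun x => x) f1 x 1 (f2 x)); [apply (is_derive_id x) | apply Hf, Hx | apply Rmult_comm].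
  + intros x Hx; destruct Hf as [_ [_ Hb]].
    destruct (Hb x (p + 1) Hx) as [_ [B1 _]]; destruct (Hb x (p + 2) Hx) as [_ [_ B2]].
    specialize (B1 ltac:(lra)); specialize (B2 ltac:(lra)).
    eapply Rle_trans; [apply Rabs_triang|]. rewrite Rabs_mult, (Rabs_pos_eq x) by lra.
    assert (x * Rabs (f2 x) <= C * Rpower x (- p - 1)).
    { replace (- p - 1) with (1 + - (p + 2)) by ring.
      rewrite <- Rpower_mul_base by exact Hx.
      replace (C * (x * Rpower x (- (p + 2)))) with (x * (C * Rpower x (- (p + 2)))) by ring.
      apply Rmult_le_compat_l; lra. }
    replace (- (p + 1)) with (- p - 1) in B1 by ring.
    apply Rle_trans with (2 * C * Rpower x (- p - 1)); [lra|].
    apply Rmult_le_compat_r; [left; apply Rpower_pos|].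
    replace (C * (1 + 2 / p + / (1 - p)) * p) with (2 * C + C * (p + / (1 - p) * p)) by (field; lra).
    assert (0 <= C * (p + / (1 - p) * p)) by (apply Rmult_le_pos; [lra | nra]). lra.
- intros x Hx; unfold h; rewrite Rabs_mult, (Rabs_pos_eq x) by lra.
  apply Rle_trans with (C * Rpower x (- p)).
  + replace (- p) with (1 + - (p + 1)) by ring.
    rewrite <- Rpower_mul_base by exact Hx.
    replace (C * (x * Rpower x (- (p + 1)))) with (x * (C * Rpower x (- (p + 1)))) by ring.
    apply Rmult_le_compat_l; [lra|]. apply Hf; lra.
  + apply Rmult_le_compat_r; [left; apply Rpower_pos | unfold Rdiv; nra].
- intros x Hx; unfold H.
  apply Rle_trans with (C * Rpower x (1 - p) + C / (1 - p) * Rpower x (1 - p)).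
  + eapply Rle_trans; [apply Rabs_triang|]. rewrite Rabs_Ropp, Rabs_mult, (Rabs_pos_eq x) by lra.
    apply Rplus_le_compat; [|apply Phi_bound; lra].
    unfold Rminus; rewrite <- Rpower_mul_base by exact Hx.
    replace (C * (x * Rpower x (- p))) with (x * (C * Rpower x (- p))) by ring.
    apply Rmult_le_compat_l; [lra|]. apply f_bound; lra.
  + rewrite <- Rmult_plus_distr_r.
    apply Rmult_le_compat_r; [left; apply Rpower_pos | unfold Rdiv; nra].
Qed.

(** The integral term works out because [(Phi (N x) / x)' = (N x f (N x) - Phi (N x)) / x^2 = H (N
    x) / x^2]. *)
Lemma muntz_derive (n : nat) (x : R) : 0 < x ->
  is_derive (muntz f Phi (S n)) x (muntz h H (S n) x / x).
Proof.
intros Hx; pose proof (INR_S_pos n) as Hn.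
assert (Hnx : 0 < INR (S n) * x) by (apply Rmult_lt_0_compat; assumption).
replace (muntz h H (S n) x / x) with
  (psum (fun k => INR (S k) * f1 (INR (S k) * x)) (S n)
   - (INR (S n) * f (INR (S n) * x) * / x + Phi (INR (S n) * x) * (- / x ^ 2))).
2:{ unfold muntz, h, H.
    replace (psum (fun k => INR (S k) * x * f1 (INR (S k) * x)) (S n)) with
      (x * psum (fun k => INR (S k) * f1 (INR (S k) * x)) (S n))
      by (rewrite <- psum_scal; apply psum_ext; intros; ring).
    field; lra. }
apply (is_derive_minus (fun y => psum (fun k => f (INR (S k) * y)) (S n)) (fun y => Phi (INR (S n) * y) / y)).
- apply (psum_derive (fun k y => f (INR (S k) * y)) (fun k y => INR (S k) * f1 (INR (S k) * y))).
  intros k; apply is_derive_comp_scal, Hf, Rmult_lt_0_compat; [apply INR_S_pos | exact Hx].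
- apply (is_derive_mult (fun y => Phi (INR (S n) * y)) Rinv); [|auto_derive; [lra | field; lra]|apply Rmult_comm].
  apply is_derive_comp_scal, HPhi, Hnx.
Qed.

Lemma muntz_prim_derive (n : nat) (x : R) : 0 < x ->
  is_derive (muntz_prim Phi Psi (S n)) x (muntz f Phi (S n) x).
Proof.
intros Hx; pose proof (INR_S_pos n) as Hn.
assert (Hnx : 0 < INR (S n) * x) by (apply Rmult_lt_0_compat; assumption).
unfold muntz.
replace (Phi (INR (S n) * x) / x) with (INR (S n) * (Phi (INR (S n) * x) / (INR (S n) * x))) by (field; lra).
apply (is_derive_minus (fun y => psum (fun k => Phi (INR (S k) * y) / INR (S k)) (S n)) (fun y => Psi (INR (S n) * y))).
- apply (psum_derive (fun k y => Phi (INR (S k) * y) / INR (S k)) (fun k y => f (INR (S k) * y))).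
  intros k; pose proof (INR_S_pos k) as Hk.
  apply (is_derive_ext (fun y => / INR (S k) * Phi (INR (S k) * y))); [intros y; R_eq; unfold Rdiv; ring|].
  replace (f (INR (S k) * x)) with (/ INR (S k) * (INR (S k) * f (INR (S k) * x))) by (field; lra).
  apply is_derive_scal, is_derive_comp_scal, HPhi, Rmult_lt_0_compat; assumption.
- apply is_derive_comp_scal, HPsi, Hnx.
Qed.

(** The exponent [p = 0] gives linear bounds for [Phi] and [Psi]. The constant grows with [n], which
    is harmless as [n] is fixed here. *)
Lemma muntz_prim_zero (n : nat) : lim_zero (muntz_prim Phi Psi (S n)) 0.
Proof.
pose proof regular_const_pos as HC.
apply (lim_zero_of_bound _ 0 (psum (fun _ => C) (S n) + C * INR (S n)) 1 Rlt_0_1); intros x Hx.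
rewrite Rminus_0_r, Rpower_1 by exact Hx.
assert (B1 : forall y, 0 < y -> Rabs (Phi y) <= C * y).
{ intros y Hy; pose proof (Phi_bound 0 y ltac:(lra) Hy) as B.
  rewrite Rminus_0_r, Rpower_1, Rdiv_1_r in B by exact Hy; exact B. }
assert (B2 : forall y, 0 < y -> Rabs (Psi y) <= C * y).
{ intros y Hy; pose proof (Psi_bound 0 y ltac:(lra) Hy) as B.
  rewrite Rminus_0_r, Rpower_1, !Rdiv_1_r in B by exact Hy; exact B. }
unfold muntz_prim; eapply Rle_trans; [apply Rabs_triang|]. rewrite Rabs_Ropp, Rmult_plus_distr_r.
apply Rplus_le_compat.
- eapply Rle_trans; [apply psum_Rabs|].
  rewrite Rmult_comm, <- psum_scal. apply psum_le; intros k _.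
  pose proof (INR_S_pos k) as Hk.
  rewrite Rabs_div, (Rabs_pos_eq (INR (S k))) by lra.
  apply Rle_div_l; [lra|].
  eapply Rle_trans; [apply B1, Rmult_lt_0_compat; assumption|]. apply Req_le; ring.
- eapply Rle_trans; [apply B2, Rmult_lt_0_compat; [apply INR_S_pos | exact Hx]|]. apply Req_le; ring.
Qed.

(** Makes the limit eligible for a second application of [muntz_formula]. The primitive [E] is
    chosen before [p], so that it serves exponents on both sides of [Re s]; it is also identified as
    a limit, from which its growth is computed later. *)
Lemma muntz_lim_admissible : exists E : R -> R,
  (forall p, 0 < p < 1 -> exists K, admissible p K (muntz_lim f Phi) E) /\
  (forall x, 0 < x -> is_lim_seq (fun n => muntz_prim Phi Psi (S n) x) (E x)).
Proof.
pose (g := muntz_lim f Phi).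
assert (Hpos : forall p, 0 < p < 1 -> 0 <= C * (1 + / p + / (1 - p))).
{ intros p Hp; eapply admissible_const_pos; apply regular_admissible, Hp. }
assert (Hgb : forall p x, 0 < p < 1 -> 0 < x ->
  Rabs (g x) <= 3 * (C * (1 + / p + / (1 - p))) * Rpower x (- p)).
{ intros p x Hp Hx; rewrite <- (Rminus_0_r (g x)).
  apply is_lim_seq_Rabs_le with (u := fun n => muntz f Phi (S n) x).
  - apply (muntz_limit p (C * (1 + / p + / (1 - p)))); [lra | auto | apply regular_admissible, Hp | exact Hx].
  - intros n; rewrite Rminus_0_r; apply muntz_bound; [lra | apply regular_admissible, Hp | exact Hx]. }
assert (Hgc : forall x, 0 < x -> continuous g x).
{ intros x Hx; apply (muntz_lim_continuous (1/2) (C * (1 + / (1/2) + / (1 - 1/2)))); [lra | apply Hpos; lra | | exact Hx].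
  apply regular_admissible; lra. }
(* The exponent [1/2] is a representative of (0, 1), used only to make [g] integrable at 0. *)
destruct (antiderivative_at_zero g (3 * (C * (1 + / (1/2) + / (1 - 1/2)))) (1/2) ltac:(lra) Hgc)
  as [E [HE HEb]].
{ intros x Hx; replace (1/2 - 1) with (- (1/2)) by field. apply Hgb; lra. }
assert (HE0 : lim_zero E 0).
{ eapply (lim_zero_of_bound E 0 _ (1/2)); [lra|]; intros x Hx; rewrite Rminus_0_r; apply HEb, Hx. }
exists E; split.
- intros p Hp.
  set (Kf := C * (1 + / p + / (1 - p))).
  set (Kh := C * (1 + 2 / p + / (1 - p))).
  assert (HKf : 0 <= Kf) by (apply Hpos, Hp).
  assert (HKh : 0 <= Kh) by (eapply admissible_const_pos; apply regular_euler_admissible, Hp).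
  assert (H1 : 0 < / p) by (apply Rinv_0_lt_compat; lra).
  assert (H2 : 0 < / (1 - p)) by (apply Rinv_0_lt_compat; lra).
  exists (3 * Kh / p + (3 * Kf + 3 * Kf / (1 - p))).
  assert (A1 : 0 <= 3 * Kh / p) by (apply Rdiv_le_0_compat; lra).
  assert (A2 : 0 <= 3 * Kf / (1 - p)) by (apply Rdiv_le_0_compat; lra).
  split; [split; [exact HE|]|split].
  + intros w v Hwv.
    assert (Hmono : 0 <= Rpower w (- p) - Rpower v (- p)) by (pose proof (Rpower_ge_base w v (- p)); lra).
    apply Rle_trans with (3 * Kh / p * (Rpower w (- p) - Rpower v (- p)));
      [|apply Rmult_le_compat_r; lra].
    change (muntz_lim f Phi) with g. rewrite <- (Rminus_0_r (g v - g w)).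
    (* Only the approximants are differentiated; the bound on their increments is uniform in [n] and
       survives the limit. *)
    apply is_lim_seq_Rabs_le with (u := fun n => muntz f Phi (S n) v - muntz f Phi (S n) w).
    * apply is_lim_seq_minus'; apply (muntz_limit p Kf); try (apply regular_admissible, Hp); lra.
    * intros n; rewrite Rminus_0_r.
      eapply Rle_trans; [apply (derive_power_bound (muntz f Phi (S n)) (fun x => muntz h H (S n) x / x) (3 * Kh) (- p))|].
      -- lra.
      -- exact Hwv.
      -- intros x Hx; apply muntz_derive, Hx.
      -- intros x Hx; rewrite Rabs_div, (Rabs_pos_eq x) by lra.
         rewrite <- Rpower_div_base by exact Hx.
         unfold Rdiv; rewrite <- Rmult_assoc. apply Rmult_le_compat_r; [left; apply Rinv_0_lt_compat, Hx|].
         apply muntz_bound; [lra | apply regular_euler_admissible, Hp | exact Hx].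
      -- apply Req_le; field; lra.
  + intros x Hx; eapply Rle_trans; [apply (Hgb p x Hp Hx)|]. fold Kf.
    apply Rmult_le_compat_r; [left; apply Rpower_pos | lra].
  + intros x Hx; eapply Rle_trans; [apply (antiderivative_bound E g (3 * Kf) (1 - p)); auto; [lra|]|].
    * intros y Hy; replace (1 - p - 1) with (- p) by ring. apply Hgb; assumption.
    * apply Rmult_le_compat_r; [left; apply Rpower_pos | lra].
- intros x Hx.
  set (Kf := C * (1 + / (1/2) + / (1 - 1/2))).
  assert (HKf : 0 <= Kf) by (apply Hpos; lra).
  apply (is_lim_seq_of_bound _ _ (Kf / (1/2) * Rpower x (1/2)) (1/2)); [lra|]; intros n.
  (* The error of the approximants is at most a constant times [n^(-1/2) y^(-1/2)], up to the shift
     of [n]. This is integrable at 0, so the primitives converge at the same rate in [n]. *)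
  eapply Rle_trans; [apply (antiderivative_bound (fun y => muntz_prim Phi Psi (S n) y - E y)
    (fun y => muntz f Phi (S n) y - g y) (Kf * Rpower (INR (S n)) (- (1/2))) (1/2)); [lra| | | |exact Hx]|].
  + rewrite <- (Rminus_0_r 0); apply (lim_zero_minus (muntz_prim Phi Psi (S n)) E); [apply muntz_prim_zero | exact HE0].
  + intros y Hy; apply (is_derive_minus (muntz_prim Phi Psi (S n)) E); [apply muntz_prim_derive, Hy | apply HE, Hy].
  + intros y Hy; replace (1/2 - 1) with (- (1/2)) by field.
    eapply Rle_trans; [apply (muntz_limit (1/2) Kf f Phi y); [lra | exact HKf | apply regular_admissible; lra | exact Hy]|].
    apply Req_le; ring.
  + apply Req_le; field.
Qed.

End Regular.

(** * Asymptotics of the iterated primitive *)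

(** Comparison with the integral of [x^(-1-b)]: its value over [[M, M + 1]] is a value of the
    integrand there, hence at least the next term. *)
Lemma p_series_tail (b : R) (K M : nat) : 0 < b -> (1 <= K <= M)%nat ->
  psum (fun k => Rpower (INR (S k)) (- 1 - b)) M - psum (fun k => Rpower (INR (S k)) (- 1 - b)) K
    <= / b * (Rpower (INR K) (- b) - Rpower (INR M) (- b)).
Proof.
intros Hb [HK HM]; induction HM as [|M HM IH]; [apply Req_le; ring|].
cbn [psum].
assert (HMp : 1 <= INR M) by (apply (le_INR 1); lia).
destruct (is_derive_mvt (fun x => Rpower x (- b) / - b) (fun x => Rpower x (- b - 1)) (INR M) (INR (S M)))
  as [c [Hc Hd]].
- rewrite S_INR; lra.
- intros x Hx; apply is_derive_Rpower_div; [lra | exact Hx].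
- assert (Rpower (INR (S M)) (- 1 - b) <= Rpower c (- b - 1)).
  { replace (- 1 - b) with (- b - 1) by ring. apply Rpower_ge_base; lra. }
  rewrite (S_INR M) in Hd at 2. replace (INR M + 1 - INR M) with 1 in Hd by ring.
  assert (/ b * (Rpower (INR M) (- b) - Rpower (INR (S M)) (- b)) = Rpower c (- b - 1)).
  { rewrite <- (Rmult_1_r (Rpower c (- b - 1))), <- Hd; field; lra. }
  lra.
Qed.

Lemma p_series_bound (b : R) (N : nat) : 0 < b ->
  psum (fun k => Rpower (INR (S k)) (- 1 - b)) N <= 1 + / b.
Proof.
intros Hb; assert (0 < / b) by (apply Rinv_0_lt_compat, Hb).
assert (H1 : forall r, Rpower 1 r = 1) by (intros r; unfold Rpower; rewrite ln_1, Rmult_0_r, exp_0; reflexivity).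
destruct N as [|n]; [simpl; lra|].
pose proof (p_series_tail b 1 (S n) Hb ltac:(lia)) as T.
change (psum (fun k => Rpower (INR (S k)) (- 1 - b)) 1) with (0 + Rpower (INR 1) (- 1 - b)) in T.
change (INR 1) with 1 in T. rewrite !H1 in T.
pose proof (Rpower_pos (INR (S n)) (- b)). nra.
Qed.

Definition harmonic (N : nat) : R := psum (fun k => / INR (S k)) N.

(** The limit that [euler_gamma] selects exists because [H_N - ln N] is [muntz] at 1 for [/ y] with
    primitive [ln]. *)
Lemma euler_gamma_limit : is_lim_seq (fun n => harmonic (S n) - ln (INR (S n))) euler_gamma.
Proof.
assert (Hc : controlled 1 1 Rinv ln).
{ apply (controlled_derive 1 1 Rinv (fun x => - / x ^ 2) ln Rlt_0_1).
  - intros x Hx; apply is_derive_Reals, derivable_pt_lim_ln, Hx.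
  - intros x Hx; auto_derive; [lra | field; lra].
  - intros x Hx; replace (- (1) - 1) with (- (1 + 1)) by ring.
    rewrite Rpower_Ropp, Rpower_plus, Rpower_1, Rabs_Ropp by exact Hx.
    rewrite Rabs_pos_eq; [apply Req_le; field; lra | left; apply Rinv_0_lt_compat; nra]. }
destruct (muntz_limit 1 1 Rinv ln 1 Rlt_0_1 Rle_0_1 Hc Rlt_0_1) as [Hl _].
assert (Hu : Un_cv (fun n => sum_f_R0 (fun k => / INR (S k)) n - ln (INR (S n))) euler_gamma).
{ unfold euler_gamma; apply epsilon_spec. exists (muntz_lim Rinv ln 1).
  apply is_lim_seq_Reals. revert Hl; apply is_lim_seq_ext; intros n.
  unfold muntz; rewrite psum_sum_f_R0, Rmult_1_r, Rdiv_1_r.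
  f_equal; apply psum_ext; intros k _; rewrite Rmult_1_r; reflexivity. }
apply is_lim_seq_Reals in Hu; revert Hu; apply is_lim_seq_ext; intros n.
rewrite psum_sum_f_R0; reflexivity.
Qed.

(** With [y = e ln x] this is [|y| <= exp y + exp (-y)]. *)
Lemma ln_power_bound (e x : R) : 0 < e -> 0 < x ->
  Rabs (ln x) <= / e * (Rpower x e + Rpower x (- e)).
Proof.
intros He Hx; apply Rmult_le_reg_l with e; [exact He|].
rewrite <- Rmult_assoc, Rinv_r, Rmult_1_l by lra.
replace (e * Rabs (ln x)) with (Rabs (e * ln x)) by (rewrite Rabs_mult, (Rabs_pos_eq e) by lra; reflexivity).
unfold Rpower; replace (- e * ln x) with (- (e * ln x)) by ring.
generalize (e * ln x); intros y.
pose proof (exp_ineq1_le y); pose proof (exp_ineq1_le (- y)).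
pose proof (exp_pos y); pose proof (exp_pos (- y)).
apply Rabs_le; split; lra.
Qed.

Lemma is_lim_seq_of_lim_infty (A : R -> R) (l x : R) : 0 < x ->
  lim_infty A l -> is_lim_seq (fun n => A (INR (S n) * x)) l.
Proof.
intros Hx HA; apply is_lim_seq_spec; intros eps.
destruct (proj1 (lim_infty_spec A l) HA eps (cond_pos eps)) as [M [HM HM']].
destruct (INR_unbounded (M / x)) as [N HN].
exists N; intros n Hn; apply HM'.
apply Rmult_lt_reg_r with (/ x); [apply Rinv_0_lt_compat, Hx|].
replace (INR (S n) * x * / x) with (INR (S n)) by (field; lra).
apply le_INR in Hn; rewrite S_INR; unfold Rdiv in HN; lra.
Qed.

Section Asymptotics.

Variables (e C : R) (f f1 f2 Phi Psi E : R -> R).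
Hypothesis (He : 0 < e <= 1 / 8) (Hf : regular e C f f1 f2).
Hypothesis HPhi : forall x, 0 < x -> is_derive Phi x (f x).
Hypothesis HPhi0 : lim_zero Phi 0.
Hypothesis HPsi : forall x, 0 < x -> is_derive Psi x (Phi x / x).
Hypothesis HPsi0 : lim_zero Psi 0.
Hypothesis HE : forall x, 0 < x -> is_lim_seq (fun n => muntz_prim Phi Psi (S n) x) (E x).

Let HC : 0 <= C := regular_const_pos e C f f1 f2 He Hf.

(** The rate [2 e] leaves room for a logarithm, which costs [x^e]. *)
Lemma Phi_limit : exists I K, Improper f I /\
  forall x, 0 < x -> Rabs (Phi x - I) <= K * Rpower x (- (2 * e)).
Proof.
destruct (limit_at_infty Phi (C / (2 * e)) (2 * e)) as [I HI]; [lra| |].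
- intros w v Hwv.
  eapply Rle_trans; [apply (derive_power_bound Phi f C (- (2 * e))); auto; [lra|]|].
  + intros x Hx; replace (- (2 * e) - 1) with (- (1 + 2 * e)) by ring.
    apply (f_bound e C f f1 f2 Hf); [exact Hx | lra].
  + replace (C / - (2 * e) * (Rpower v (- (2 * e)) - Rpower w (- (2 * e))))
      with (C / (2 * e) * (Rpower w (- (2 * e)) - Rpower v (- (2 * e)))) by (field; lra).
    apply Rmult_le_compat_l; [apply Rdiv_le_0_compat; lra | pose proof (Rpower_pos v (- (2 * e))); lra].
- exists I, (C / (2 * e)); split; [split|exact HI].
  + intros x Hx; apply (ex_derive_continuous f); eexists; apply Hf, Hx.
  + exists Phi; split; [exact HPhi | split; [exact HPhi0|]].
    apply (lim_infty_of_bound _ _ (C / (2 * e)) (2 * e)); [lra | exact HI].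
Qed.

(** By parts, [Phi ln - Psi] is a primitive of [f ln]; this links the logarithmic moment to the
    function [Psi] that occurs in [muntz_prim]. *)
Lemma log_moment_limit : exists L, Improper (fun x => f x * ln x) L /\
  lim_infty (fun x => Phi x * ln x - Psi x) L.
Proof.
set (Lam := fun x => Phi x * ln x - Psi x).
assert (Hi : 0 < / e) by (apply Rinv_0_lt_compat; lra).
assert (Hd : forall x, 0 < x -> is_derive Lam x (f x * ln x)).
{ intros x Hx.
  replace (f x * ln x) with ((f x * ln x + Phi x * / x) - Phi x / x) by (unfold Rdiv; ring).
  apply (is_derive_minus (fun x => Phi x * ln x) Psi); [|apply HPsi, Hx].
  apply (is_derive_mult Phi ln x (f x) (/ x)); [apply HPhi, Hx | | apply Rmult_comm].
  apply is_derive_Reals, derivable_pt_lim_ln, Hx. }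
assert (Hcont : forall x, 0 < x -> continuous (fun x => f x * ln x) x).
{ intros x Hx; apply (continuous_mult f ln).
  - apply (ex_derive_continuous f); eexists; apply Hf, Hx.
  - apply (ex_derive_continuous ln); eexists; apply is_derive_Reals, derivable_pt_lim_ln, Hx. }
(* The logarithm is at most [x^e + x^(-e)] up to a constant. Two bounds on [a] whose exponents
   differ by [2 e] bring both products to the same power. *)
assert (Hprod : forall A r1 r2 a x, 0 < x -> Rabs a <= A * Rpower x r1 -> Rabs a <= A * Rpower x r2 ->
  r1 + e = r2 - e -> Rabs (a * ln x) <= 2 * A / e * Rpower x (r1 + e)).
{ intros A r1 r2 a x Hx H1 H2 Hr.
  rewrite Rabs_mult.
  eapply Rle_trans; [apply Rmult_le_compat_l; [apply Rabs_pos | apply (ln_power_bound e); lra]|].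
  replace (Rabs a * (/ e * (Rpower x e + Rpower x (- e))))
    with (/ e * (Rabs a * Rpower x e + Rabs a * Rpower x (- e))) by ring.
  replace (2 * A / e * Rpower x (r1 + e)) with
    (/ e * (A * Rpower x r1 * Rpower x e + A * Rpower x r2 * Rpower x (- e))).
  2:{ rewrite !Rmult_assoc, <- !Rpower_plus. replace (r2 + - e) with (r1 + e) by lra. field; lra. }
  apply Rmult_le_compat_l; [lra|].
  apply Rplus_le_compat; apply Rmult_le_compat_r; try (left; apply Rpower_pos); assumption. }
destruct (limit_at_infty Lam (2 * C / e / e) e) as [L HL]; [lra| |].
- intros w v Hwv.
  eapply Rle_trans; [apply (derive_power_bound Lam (fun x => f x * ln x) (2 * C / e) (- e)); auto; [lra|]|].
  + intros x Hx; replace (- e - 1) with ((- (1 + 2 * e)) + e) by ring.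
    apply Hprod with (r2 := Ropp 1); [exact Hx | | | ring];
      apply (f_bound e C f f1 f2 Hf); lra.
  + replace (2 * C / e / - e * (Rpower v (- e) - Rpower w (- e)))
      with (2 * C / e / e * (Rpower w (- e) - Rpower v (- e))) by (field; lra).
    apply Rmult_le_compat_l; [apply Rdiv_le_0_compat; [apply Rdiv_le_0_compat|]; lra | pose proof (Rpower_pos v (- e)); lra].
- assert (HLl : lim_infty Lam L)
    by (apply (lim_infty_of_bound _ _ (2 * C / e / e) e); [lra | exact HL]).
  exists L; split; [split; [exact Hcont | exists Lam; split; [exact Hd | split; [|exact HLl]]] | exact HLl].
  (* [A] is the constant of [Phi_bound] at [p = 1/2 + e]; it also dominates the one at
     [p = 1/2 - e]. *)
  set (A := C / (1 / 2 - e)).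
  assert (HA : 0 <= A) by (apply Rdiv_le_0_compat; lra).
  apply (lim_zero_of_bound _ _ (2 * A / e + C / (1 - 1 / 2) / (1 - 1 / 2)) (1 / 2)); [lra|].
  intros x Hx; rewrite Rminus_0_r, Rmult_plus_distr_r; unfold Lam.
  eapply Rle_trans; [apply Rabs_triang|]. rewrite Rabs_Ropp; apply Rplus_le_compat.
  + replace (1 / 2) with ((1 / 2 - e) + e) at 1 by ring.
    apply Hprod with (r2 := 1 / 2 + e); [exact Hx | | | ring].
    * pose proof (Phi_bound e C f f1 f2 Phi He Hf HPhi HPhi0 (1 / 2 + e) x ltac:(lra) Hx) as B.
      replace (1 - (1 / 2 + e)) with (1 / 2 - e) in B by field. exact B.
    * pose proof (Phi_bound e C f f1 f2 Phi He Hf HPhi HPhi0 (1 / 2 - e) x ltac:(lra) Hx) as B.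
      replace (1 - (1 / 2 - e)) with (1 / 2 + e) in B by field.
      eapply Rle_trans; [exact B|]. apply Rmult_le_compat_r; [left; apply Rpower_pos|].
      unfold A, Rdiv; apply Rmult_le_compat_l; [exact HC|]. apply Rinv_le_contravar; lra.
  + pose proof (Psi_bound e C f f1 f2 Phi Psi He Hf HPhi HPhi0 HPsi HPsi0 (1 / 2) x ltac:(lra) Hx) as B.
    replace (1 - 1 / 2) with (1 / 2) in B |- * by field. exact B.
Qed.

(** In [muntz_prim], replacing [Phi (k x)] by [I] turns the sum into [I H_N], and [Psi (N x)] is
    [I ln (N x) - L + o(1)]. The logarithms of [N] combine with [H_N] into [euler_gamma]; the
    replacement costs at most [K x^(-2 e)] times the sum of [k^(-1 - 2 e)]. *)
Lemma E_asymptotics (I K L : R) :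
  (forall x, 0 < x -> Rabs (Phi x - I) <= K * Rpower x (- (2 * e))) ->
  lim_infty (fun x => Phi x * ln x - Psi x) L ->
  lim_infty (fun x => E x + I * ln x) (euler_gamma * I + L).
Proof.
intros HI HL.
assert (Hi : 0 < / e) by (apply Rinv_0_lt_compat; lra).
assert (HK : 0 <= K).
{ pose proof (HI 1 Rlt_0_1); pose proof (Rabs_pos (Phi 1 - I)); pose proof (Rpower_pos 1 (- (2 * e))); nra. }
assert (HRln : lim_infty (fun x => (Phi x - I) * ln x) 0).
(* [B] bounds [Phi - I] everywhere: [C + |I|] suffices up to 1 and [K] beyond. It handles the part
   [x^(-e)] of the logarithm, and the decay [x^(-2 e)] handles the part [x^e]. *)
{ set (B := K + (C + Rabs I)).
  apply (lim_infty_of_bound _ _ (/ e * (K + B)) e); [lra|].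
  intros x Hx; rewrite Rminus_0_r, Rabs_mult.
  assert (HB : Rabs (Phi x - I) <= B).
  { unfold B; destruct (Rle_lt_dec x 1) as [Hx1 | Hx1].
    - pose proof (Phi_bound e C f f1 f2 Phi He Hf HPhi HPhi0 0 x ltac:(lra) Hx) as P.
      rewrite Rminus_0_r, Rpower_1, Rdiv_1_r in P by exact Hx.
      eapply Rle_trans; [apply Rabs_triang|]. rewrite Rabs_Ropp. nra.
    - pose proof (HI x Hx). pose proof (Rabs_pos I).
      assert (Rpower x (- (2 * e)) <= 1).
      { rewrite <- (Rpower_O x) by lra. apply Rle_Rpower; lra. }
      nra. }
  eapply Rle_trans; [apply Rmult_le_compat_l; [apply Rabs_pos | apply (ln_power_bound e); lra]|].
  replace (Rabs (Phi x - I) * (/ e * (Rpower x e + Rpower x (- e))))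
    with (/ e * (Rabs (Phi x - I) * Rpower x e + Rabs (Phi x - I) * Rpower x (- e))) by ring.
  rewrite (Rmult_assoc (/ e)), Rmult_plus_distr_r. apply Rmult_le_compat_l; [lra|].
  apply Rplus_le_compat.
  - replace (- e) with (- (2 * e) + e) by ring. rewrite Rpower_plus, <- Rmult_assoc.
    apply Rmult_le_compat_r; [left; apply Rpower_pos | apply HI, Hx].
  - apply Rmult_le_compat_r; [left; apply Rpower_pos | exact HB]. }
apply (lim_infty_of_bound _ _ (K * (1 + / (2 * e))) (2 * e)); [lra|]; intros x Hx.
(* [muntz_prim] at [x] is within [O(x^(- 2 e))], uniformly in [n], of a sequence whose limit is known. *)
assert (Hlim : is_lim_seq (fun n =>
    (muntz_prim Phi Psi (S n) x + I * ln x) - (I * (harmonic (S n) - ln (INR (S n)))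
     + ((Phi (INR (S n) * x) * ln (INR (S n) * x) - Psi (INR (S n) * x))
        - (Phi (INR (S n) * x) - I) * ln (INR (S n) * x))))
    (E x + I * ln x - (I * euler_gamma + (L - 0)))).
{ apply is_lim_seq_minus'.
  - apply is_lim_seq_plus'; [apply HE, Hx | apply is_lim_seq_const].
  - apply is_lim_seq_plus'.
    + apply is_lim_seq_mult'; [apply is_lim_seq_const | apply euler_gamma_limit].
    + apply is_lim_seq_minus'.
      * apply (is_lim_seq_of_lim_infty (fun y => Phi y * ln y - Psi y)); assumption.
      * apply (is_lim_seq_of_lim_infty (fun y => (Phi y - I) * ln y)); assumption. }
replace (E x + I * ln x - (euler_gamma * I + L)) with (E x + I * ln x - (I * euler_gamma + (L - 0)) - 0) by ring.
apply (is_lim_seq_Rabs_le _ _ 0 _ Hlim); intros n.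
assert (Es : psum (fun k => Phi (INR (S k) * x) / INR (S k)) (S n) =
  psum (fun k => (Phi (INR (S k) * x) - I) / INR (S k)) (S n) + I * harmonic (S n)).
{ unfold harmonic; rewrite <- psum_scal, <- psum_plus. apply psum_ext; intros k _; unfold Rdiv; ring. }
unfold muntz_prim; rewrite Es, ln_mult by (try apply INR_S_pos; exact Hx).
match goal with |- Rabs ?t <= _ =>
  replace t with (psum (fun k => (Phi (INR (S k) * x) - I) / INR (S k)) (S n)) by ring end.
eapply Rle_trans; [apply psum_Rabs|].
apply Rle_trans with (psum (fun k => K * Rpower x (- (2 * e)) * Rpower (INR (S k)) (- 1 - 2 * e)) (S n)).
- apply psum_le; intros k _. pose proof (INR_S_pos k) as Hk.
  assert (Hkx : 0 < INR (S k) * x) by (apply Rmult_lt_0_compat; assumption).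
  rewrite Rabs_div, (Rabs_pos_eq (INR (S k))) by lra.
  apply Rle_div_l; [lra|]. eapply Rle_trans; [apply HI, Hkx|].
  rewrite <- Rpower_mult_distr by assumption.
  replace (- (2 * e)) with (1 + (- 1 - 2 * e)) at 1 by ring.
  rewrite <- Rpower_mul_base by exact Hk. apply Req_le; ring.
- rewrite psum_scal.
  replace (K * (1 + / (2 * e)) * Rpower x (- (2 * e))) with (K * Rpower x (- (2 * e)) * (1 + / (2 * e))) by ring.
  apply Rmult_le_compat_l; [apply Rmult_le_pos; [exact HK | left; apply Rpower_pos]|].
  apply p_series_bound; lra.
Qed.

End Asymptotics.

(** * Divisor sums as sums over lattice points under a hyperbola *)

Lemma filter_count (p : nat -> bool) (m n : nat) :
  INR (length (filter p (seq m n))) = psum (fun j => if p (m + j)%nat then 1 else 0) n.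
Proof.
induction n as [|n IH]; [reflexivity|].
rewrite seq_S, filter_app, length_app, plus_INR, IH. simpl.
destruct (p (m + n)%nat); simpl; ring.
Qed.

Lemma psum_zero_tail (a : nat -> R) (N J : nat) : (N <= J)%nat ->
  (forall k, (N <= k)%nat -> a k = 0) -> psum a J = psum a N.
Proof.
intros HNJ H; induction HNJ as [|J HNJ IH]; [reflexivity|].
simpl; rewrite IH, H by exact HNJ; ring.
Qed.

Lemma ndiv_psum (N J : nat) : (S N <= J)%nat ->
  INR (ndiv (S N)) = psum (fun j => if Nat.eqb (S N mod S j) 0 then 1 else 0) J.
Proof.
intros HJ; unfold ndiv; rewrite filter_count.
rewrite (psum_zero_tail _ (S N) J HJ); [reflexivity|].
intros k Hk; rewrite Nat.mod_small by lia. reflexivity.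
Qed.

(** A multiple of [S d] is passed at [S N] exactly when [S d] divides [S N]; Euclidean division
    decides both cases. *)
Lemma div_succ (N d : nat) :
  (S N / S d = N / S d + (if Nat.eqb (S N mod S d) 0 then 1 else 0))%nat.
Proof.
pose proof (Nat.div_mod_eq N (S d)) as E1. pose proof (Nat.div_mod_eq (S N) (S d)) as E2.
pose proof (Nat.mod_upper_bound N (S d) ltac:(lia)) as B1.
pose proof (Nat.mod_upper_bound (S N) (S d) ltac:(lia)) as B2.
destruct (Nat.eqb_spec (S N mod S d) 0) as [Z | Z]; nia.
Qed.

(** From [N] to [S N], row [j] gains an entry exactly when [S j] divides [S N], and that entry is
    [a (S N)]. The number [J] of rows is kept apart from [N] so that it stays fixed in the
    induction; rows past [N] are empty. *)
Lemma divisor_sum_aux (a : nat -> R) (N J : nat) : (N <= J)%nat ->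
  psum (fun k => INR (ndiv (S k)) * a (S k)) N =
  psum (fun j => psum (fun i => a (S i * S j)%nat) (N / S j)) J.
Proof.
induction N as [|N IH]; intros HJ.
- simpl psum at 1. symmetry; rewrite (psum_zero_tail _ 0 J); [reflexivity | lia|].
  intros k _; rewrite Nat.Div0.div_0_l; reflexivity.
- cbn [psum]. rewrite IH by lia. rewrite (ndiv_psum N J HJ), Rmult_comm, <- psum_scal, <- psum_plus.
  apply psum_ext; intros j _. rewrite div_succ.
  destruct (Nat.eqb_spec (S N mod S j) 0) as [Z | Z].
  + rewrite Nat.add_1_r. cbn [psum]. rewrite Rmult_1_r; do 2 f_equal.
    pose proof (Nat.div_mod_eq (S N) (S j)) as E2. pose proof (div_succ N j) as E1.
    rewrite Z, Nat.eqb_refl in E1; rewrite Z, E1 in E2. nia.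
  + rewrite Nat.add_0_r; ring.
Qed.

Lemma divisor_sum (a : nat -> R) (N : nat) :
  psum (fun k => INR (ndiv (S k)) * a (S k)) N =
  psum (fun j => psum (fun i => a (S i * S j)%nat) (N / S j)) N.
Proof. apply divisor_sum_aux; lia. Qed.

(** * The divisor series *)

Lemma psum_diff_le (a b : nat -> R) (K M : nat) : (K <= M)%nat ->
  (forall k, Rabs (a k) <= b k) -> Rabs (psum a M - psum a K) <= psum b M - psum b K.
Proof.
intros HKM H; induction HKM as [|M HKM IH].
- replace (psum a K - psum a K) with 0 by ring. rewrite Rabs_R0; lra.
- cbn [psum]. replace (psum a M + a M - psum a K) with ((psum a M - psum a K) + a M) by ring.
  eapply Rle_trans; [apply Rabs_triang|]. specialize (H M); lra.
Qed.

(** The quotient [t] is at least 1, so [N < S d (t + 1) <= 2 S d t]. *)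
Lemma INR_div_ge (N d : nat) : (S d <= N)%nat -> INR N / (2 * INR (S d)) <= INR (N / S d).
Proof.
intros Hd; pose proof (INR_S_pos d) as Hp.
assert (H : (N <= 2 * S d * (N / S d))%nat).
{ pose proof (Nat.div_mod_eq N (S d)). pose proof (Nat.mod_upper_bound N (S d) ltac:(lia)).
  assert (1 <= N / S d)%nat by (apply Nat.div_le_lower_bound; lia). nia. }
apply le_INR in H; rewrite !mult_INR in H; change (INR 2) with 2 in H.
apply Rle_div_l; [lra|]. rewrite Rmult_comm; exact H.
Qed.

Section DivisorSeries.

Variables (e C : R) (f f1 f2 Phi Psi E : R -> R) (I K L q B : R).
Hypothesis (He : 0 < e <= 1 / 8) (Hf : regular e C f f1 f2).
Hypothesis HPhi : forall x, 0 < x -> is_derive Phi x (f x).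
Hypothesis HPhi0 : lim_zero Phi 0.
Hypothesis HI : forall x, 0 < x -> Rabs (Phi x - I) <= K * Rpower x (- (2 * e)).
Hypothesis HEas : lim_infty (fun x => E x + I * ln x) (euler_gamma * I + L).
Hypothesis (Hq : 0 < q) (HE : admissible q B (muntz_lim f Phi) E).

Let g := muntz_lim f Phi.
Let HC : 0 <= C := regular_const_pos e C f f1 f2 He Hf.

Lemma dilated_sum_limit (v : R) : 0 < v ->
  is_lim_seq (fun n => psum (fun i => f (INR (S i) * v)) (S n)) (g v + I / v).
Proof.
intros Hv.
apply (is_lim_seq_ext (fun n => muntz f Phi (S n) v + Phi (INR (S n) * v) / v)).
{ intros n; unfold muntz; ring. }
apply is_lim_seq_plus'.
- apply (muntz_limit (1 / 2) (C * (1 + / (1 / 2) + / (1 - 1 / 2)))); [lra | | | exact Hv].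
  + eapply admissible_const_pos; apply (regular_admissible e C f f1 f2 Phi He Hf HPhi HPhi0); lra.
  + apply (regular_admissible e C f f1 f2 Phi He Hf HPhi HPhi0); lra.
- apply is_lim_seq_mult'; [|apply is_lim_seq_const].
  apply is_lim_seq_of_lim_infty; [exact Hv|].
  apply (lim_infty_of_bound _ _ K (2 * e)); [lra | exact HI].
Qed.

(** The decay in [k] is relaxed from [4 e] to [2 e] on purpose: with [v = j x] and [k] about [N / j]
    the error is of order [N^(-2 e) j^(-1 - 2 e)], which is summable over [j] and vanishes as [N]
    grows. *)
Lemma dilated_sum_tail (v : R) (k : nat) : 0 < v -> (1 <= k)%nat ->
  Rabs (g v + I / v - psum (fun i => f (INR (S i) * v)) k)
    <= C * / (4 * e) * Rpower v (- 1 - 4 * e) * Rpower (INR k) (- (2 * e)).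
Proof.
intros Hv Hk.
apply is_lim_seq_Rabs_le with (u := fun n => psum (fun i => f (INR (S i) * v)) (S (n + k))).
{ apply (is_lim_seq_incr_n (fun n => psum (fun i => f (INR (S i) * v)) (S n)) k), dilated_sum_limit, Hv. }
intros n.
assert (Hi : 0 < / (4 * e)) by (apply Rinv_0_lt_compat; lra).
eapply Rle_trans; [apply (psum_diff_le _ (fun i => C * Rpower v (- 1 - 4 * e) * Rpower (INR (S i)) (- 1 - 4 * e)))|].
- lia.
- intros i; pose proof (INR_S_pos i) as Hi'.
  eapply Rle_trans; [apply (f_bound e C f f1 f2 Hf _ (1 + 4 * e)); [apply Rmult_lt_0_compat; assumption | lra]|].
  rewrite <- Rpower_mult_distr by assumption. replace (- (1 + 4 * e)) with (- 1 - 4 * e) by ring.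
  apply Req_le; ring.
- rewrite !psum_scal, <- Rmult_minus_distr_l.
  replace (C * / (4 * e) * Rpower v (- 1 - 4 * e) * Rpower (INR k) (- (2 * e)))
    with (C * Rpower v (- 1 - 4 * e) * (/ (4 * e) * Rpower (INR k) (- (2 * e)))) by ring.
  apply Rmult_le_compat_l; [apply Rmult_le_pos; [exact HC | left; apply Rpower_pos]|].
  eapply Rle_trans; [apply p_series_tail; [lra | lia]|].
  apply Rmult_le_compat_l; [lra|].
  apply Rle_trans with (Rpower (INR k) (- (4 * e))).
  + pose proof (Rpower_pos (INR (S (n + k))) (- (4 * e))); lra.
  + apply Rle_Rpower; [|lra]. apply (le_INR 1); exact Hk.
Qed.

(** Each truncated row of the hyperbola is completed to the full sum [F (j x)]. The part [g] of [F]
    gives [muntz g E] plus [E (N x) / x], the part [I / v] gives [I / x] times [H_N], and the terms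
    in [ln N] cancel. *)
Lemma divisor_series_limit (x : R) : 0 < x ->
  is_lim_seq (fun n => psum (fun k => INR (ndiv (S k)) * f (INR (S k) * x)) (S n))
    (muntz_lim g E x + (L + (2 * euler_gamma - ln x) * I) / x).
Proof.
intros Hx.
assert (Hi : 0 < / (4 * e)) by (apply Rinv_0_lt_compat; lra).
assert (Hi2 : 0 < / (2 * e)) by (apply Rinv_0_lt_compat; lra).
set (F := fun v => g v + I / v).
(* The factor [2^(2 e)] comes from the factor 2 lost in [INR_div_ge]. *)
set (K' := C * / (4 * e) * Rpower x (- 1 - 4 * e) * Rpower 2 (2 * e)).
assert (HK' : 0 <= K').
{ unfold K'; repeat apply Rmult_le_pos; try lra; left; apply Rpower_pos. }
assert (Herr : is_lim_seq (fun n => psum (fun k => INR (ndiv (S k)) * f (INR (S k) * x)) (S n)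
    - psum (fun j => F (INR (S j) * x)) (S n)) 0).
{ apply (is_lim_seq_null_of_bound _ (K' * (1 + / (2 * e))) (2 * e)); [lra|]; intros n.
  set (N := S n).
  rewrite (divisor_sum (fun k => f (INR k * x))).
  replace (psum _ N - psum _ N) with
    (psum (fun j => psum (fun i => f (INR (S i * S j) * x)) (N / S j) + - 1 * F (INR (S j) * x)) N)
    by (rewrite psum_plus, psum_scal; ring).
  eapply Rle_trans; [apply psum_Rabs|].
  apply Rle_trans with (psum (fun j => K' * Rpower (INR N) (- (2 * e)) * Rpower (INR (S j)) (- 1 - 2 * e)) N).
  - apply psum_le; intros j Hj.
    pose proof (INR_S_pos j) as Hjp. pose proof (INR_S_pos n) as HNp; fold N in HNp.
    assert (Hjx : 0 < INR (S j) * x) by (apply Rmult_lt_0_compat; assumption).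
    assert (H1 : (1 <= N / S j)%nat) by (apply Nat.div_le_lower_bound; lia).
    replace (psum (fun i => f (INR (S i * S j) * x)) (N / S j) + -1 * F (INR (S j) * x))
      with (- (F (INR (S j) * x) - psum (fun i => f (INR (S i) * (INR (S j) * x))) (N / S j))).
    2:{ replace (psum (fun i => f (INR (S i * S j) * x)) (N / S j))
          with (psum (fun i => f (INR (S i) * (INR (S j) * x))) (N / S j)); [ring|].
        apply psum_ext; intros i _. rewrite mult_INR, Rmult_assoc; reflexivity. }
    rewrite Rabs_Ropp. eapply Rle_trans; [apply dilated_sum_tail; assumption|].
    assert (Hpow : Rpower (INR (N / S j)) (- (2 * e)) <=
      Rpower (INR N) (- (2 * e)) * Rpower 2 (2 * e) * Rpower (INR (S j)) (2 * e)).
    { apply Rle_trans with (Rpower (INR N / (2 * INR (S j))) (- (2 * e))).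
      - apply Rpower_ge_base; [lra | split; [apply Rdiv_lt_0_compat; lra | apply INR_div_ge; exact Hj]].
      - apply Req_le; unfold Rdiv.
        rewrite <- Rpower_mult_distr by (try apply Rinv_0_lt_compat; lra).
        rewrite Rpower_inv_base, Ropp_involutive, <- Rpower_mult_distr by lra. ring. }
    rewrite <- Rpower_mult_distr by assumption.
    apply Rle_trans with (C * / (4 * e) * (Rpower (INR (S j)) (- 1 - 4 * e) * Rpower x (- 1 - 4 * e))
      * (Rpower (INR N) (- (2 * e)) * Rpower 2 (2 * e) * Rpower (INR (S j)) (2 * e))).
    + apply Rmult_le_compat_l; [|exact Hpow].
      repeat apply Rmult_le_pos; try lra; left; apply Rpower_pos.
    + replace (- 1 - 2 * e) with ((- 1 - 4 * e) + 2 * e) by ring.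
      rewrite (Rpower_plus (-1 - 4 * e)). unfold K'. apply Req_le; ring.
  - rewrite psum_scal.
    replace (K' * (1 + / (2 * e)) * Rpower (INR N) (- (2 * e)))
      with (K' * Rpower (INR N) (- (2 * e)) * (1 + / (2 * e))) by ring.
    apply Rmult_le_compat_l; [apply Rmult_le_pos; [exact HK' | left; apply Rpower_pos]|].
    apply p_series_bound; lra. }
(* One [euler_gamma] comes from the asymptotics of [E], the other from the harmonic sum; [- ln x] is
   what remains of [ln (N x)]. *)
assert (HF : is_lim_seq (fun n => muntz g E (S n) x +
    ((E (INR (S n) * x) + I * ln (INR (S n) * x)) * / x + I / x * (harmonic (S n) - ln (INR (S n)))
      - I / x * ln x))
    (muntz_lim g E x + ((euler_gamma * I + L) * / x + I / x * euler_gamma - I / x * ln x))).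
{ apply is_lim_seq_plus'.
  - apply (muntz_limit q B g E x Hq); [eapply admissible_const_pos; apply HE | apply HE | exact Hx].
  - apply is_lim_seq_minus'; [|apply is_lim_seq_const].
    apply is_lim_seq_plus'; apply is_lim_seq_mult'; try apply is_lim_seq_const.
    + apply (is_lim_seq_of_lim_infty (fun y => E y + I * ln y)); assumption.
    + apply euler_gamma_limit. }
pose proof (is_lim_seq_plus' _ _ _ _ Herr HF) as H.
replace (muntz_lim g E x + (L + (2 * euler_gamma - ln x) * I) / x) with
  (0 + (muntz_lim g E x + ((euler_gamma * I + L) * / x + I / x * euler_gamma - I / x * ln x)))
  by (field; lra).
revert H; apply is_lim_seq_ext; intros n.
assert (HS : psum (fun j => F (INR (S j) * x)) (S n) =
  psum (fun j => g (INR (S j) * x)) (S n) + I / x * harmonic (S n)).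
{ unfold harmonic, F; rewrite <- psum_scal, <- psum_plus; apply psum_ext; intros k _.
  pose proof (INR_S_pos k); field; lra. }
rewrite HS; unfold muntz; rewrite ln_mult by (try apply INR_S_pos; exact Hx).
field; lra.
Qed.

End DivisorSeries.

Lemma divisor_formula_real (e C : R) (f f1 f2 : R -> R) (s : Cplx) :
  0 < e <= 1 / 8 -> regular e C f f1 f2 -> 0 < Cre s < 1 ->
  exists (D J : R -> R) (l : Cplx),
    (forall x, 0 < x -> infinite_sum (fun n => INR (ndiv (S n)) * f (INR (S n) * x)) (D x)) /\
    (forall x, 0 < x -> Improper (fun y => f (x * y) * (ln y + 2 * euler_gamma)) (J x)) /\
    ImproperC (fun x => Cmul (RtoC (f x)) (Cpow x (Csub s (RtoC 1)))) l /\
    ImproperC (fun x => Cmul (RtoC (D x - J x)) (Cpow x (Csub s (RtoC 1))))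
      (Cmul (zeta s) (Cmul (zeta s) l)).
Proof.
intros He Hf Hs.
pose proof (regular_const_pos e C f f1 f2 He Hf) as HC.
assert (Hfb := f_bound e C f f1 f2 Hf).
destruct (antiderivative_at_zero f C 1 Rlt_0_1) as [Phi [HPhi HPhib]].
{ intros x Hx; apply (ex_derive_continuous f); eexists; apply Hf, Hx. }
{ intros x Hx; replace (1 - 1) with (- 0) by ring. apply Hfb; lra. }
assert (HPhi0 : lim_zero Phi 0).
{ apply (lim_zero_of_bound _ _ (C / 1) 1 Rlt_0_1); intros x Hx; rewrite Rminus_0_r; apply HPhib, Hx. }
destruct (antiderivative_at_zero (fun x => Phi x / x) (C / 1) 1 Rlt_0_1) as [Psi [HPsi HPsib]].
{ intros x Hx; apply (continuous_mult Phi Rinv).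
  - apply (ex_derive_continuous Phi); eexists; apply HPhi, Hx.
  - apply (ex_derive_continuous Rinv); auto_derive; lra. }
{ intros x Hx; rewrite <- Rpower_div_base by exact Hx. rewrite Rabs_div, (Rabs_pos_eq x) by lra.
  unfold Rdiv at 1 3; rewrite <- Rmult_assoc.
  apply Rmult_le_compat_r; [left; apply Rinv_0_lt_compat, Hx | apply HPhib, Hx]. }
assert (HPsi0 : lim_zero Psi 0).
{ apply (lim_zero_of_bound _ _ (C / 1 / 1) 1 Rlt_0_1); intros x Hx; rewrite Rminus_0_r; apply HPsib, Hx. }
destruct (muntz_lim_admissible e C f f1 f2 Phi Psi He Hf HPhi HPhi0 HPsi HPsi0) as [E [HEa HE]].
destruct (Phi_limit e C f f1 f2 Phi He Hf HPhi HPhi0) as [I [K [HI HIb]]].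
destruct (log_moment_limit e C f f1 f2 Phi Psi He Hf HPhi HPhi0 HPsi HPsi0) as [L [HL HLl]].
pose proof (E_asymptotics e C f f1 f2 Phi Psi E He Hf HPhi HPhi0 HE I K L HIb HLl) as HEas.
set (g := muntz_lim f Phi) in *.
(* Half the distance to the edges of the strip keeps both [Re s - d] and [Re s + d] inside (0,
   1). *)
set (d := Rmin (Cre s) (1 - Cre s) / 2).
assert (Hd : 0 < d /\ 0 < Cre s - d < 1 /\ 0 < Cre s + d < 1).
{ unfold d; pose proof (Rmin_l (Cre s) (1 - Cre s)); pose proof (Rmin_r (Cre s) (1 - Cre s)).
  assert (0 < Rmin (Cre s) (1 - Cre s)) by (apply Rmin_glb_lt; lra). lra. }
destruct Hd as [Hd [Hd1 Hd2]].
assert (Af1 := regular_admissible e C f f1 f2 Phi He Hf HPhi HPhi0 (Cre s - d) Hd1).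
assert (Af2 := regular_admissible e C f f1 f2 Phi He Hf HPhi HPhi0 (Cre s + d) Hd2).
(* [muntz_formula] takes one constant for both exponents, hence the maxima here and for [g]. *)
apply admissible_weaken with (1 := proj1 Hd1) (2 := Rmax_l _ (C * (1 + / (Cre s + d) + / (1 - (Cre s + d))))) in Af1.
apply admissible_weaken with (1 := proj1 Hd2) (2 := Rmax_r (C * (1 + / (Cre s - d) + / (1 - (Cre s - d)))) _) in Af2.
destruct (HEa _ Hd1) as [K1 Ag1]; destruct (HEa _ Hd2) as [K2 Ag2].
pose proof (admissible_weaken _ _ _ _ _ (proj1 Hd1) (Rmax_l K1 K2) Ag1) as Ag1'.
pose proof (admissible_weaken _ _ _ _ _ (proj1 Hd2) (Rmax_r K1 K2) Ag2) as Ag2'.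
set (Kf := Rmax _ _) in Af1, Af2.
destruct (Mellin_kernel_tame d s Hd Kf f) as [l [Hl _]].
{ intros x Hx; apply (ex_derive_continuous f); eexists; apply Hf, Hx. }
{ intros x Hx; split; [apply Af1, Hx | apply Af2, Hx]. }
exists (fun x => muntz_lim g E x + (L + (2 * euler_gamma - ln x) * I) / x),
  (fun x => (L + (2 * euler_gamma - ln x) * I) / x), l.
split; [|split; [|split; [exact Hl|]]].
- intros x Hx.
  pose proof (divisor_series_limit e C f f1 f2 Phi E I K L _ _ He Hf HPhi HPhi0 HIb HEas (proj1 Hd1) Ag1 x Hx) as H.
  apply is_lim_seq_Reals; revert H; apply is_lim_seq_ext; intros n.
  rewrite psum_sum_f_R0; reflexivity.
- intros x Hx.
  (* The integrand is the dilate by [x] of [f u (ln u + 2 euler_gamma - ln x)], whose integral is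
     [L + (2 euler_gamma - ln x) I]. *)
  pose proof (Improper_dilate x _ _ Hx (Improper_plus _ _ _ _ HL (Improper_scal (2 * euler_gamma - ln x) _ _ HI))) as H.
  revert H; apply Improper_ext; intros y Hy. rewrite ln_mult by assumption; ring.
- pose proof (muntz_formula d _ s f Phi Hd (proj1 Hd1) (proj2 Hd2) Af1 Af2 l Hl) as H1.
  pose proof (muntz_formula d _ s g E Hd (proj1 Hd1) (proj2 Hd2) Ag1' Ag2' _ H1) as H2.
  revert H2; apply ImproperC_ext; intros x Hx. do 2 f_equal; ring.
Qed.

(** * From the class M_alpha to power bounds on the whole half-line *)

Lemma deriv_within_cont_within (g g' : R -> R) (x : R) :
  deriv_within_nonneg g g' x -> cont_within_nonneg g x.
Proof.
intros H eps He.
destruct (H 1 Rlt_0_1) as [d [Hd Hh]].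
pose proof (Rabs_pos (g' x)) as Hg.
exists (Rmin d (eps / (1 + Rabs (g' x)))); split.
{ apply Rmin_glb_lt; [exact Hd | apply Rdiv_lt_0_compat; lra]. }
intros y Hy Hyx.
pose proof (Rmin_l d (eps / (1 + Rabs (g' x)))); pose proof (Rmin_r d (eps / (1 + Rabs (g' x)))).
destruct (Req_dec y x) as [-> | Hne].
{ replace (g x - g x) with 0 by ring. rewrite Rabs_R0; exact He. }
specialize (Hh (y - x) ltac:(lra) ltac:(lra) ltac:(lra)).
replace (x + (y - x)) with y in Hh by ring.
assert (Hq : Rabs ((g y - g x) / (y - x)) <= 1 + Rabs (g' x)).
{ replace ((g y - g x) / (y - x)) with (((g y - g x) / (y - x) - g' x) + g' x) by ring.
  eapply Rle_trans; [apply Rabs_triang | lra]. }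
replace (g y - g x) with ((g y - g x) / (y - x) * (y - x)) by (field; lra).
rewrite Rabs_mult.
apply Rle_lt_trans with ((1 + Rabs (g' x)) * Rabs (y - x)).
- apply Rmult_le_compat_r; [apply Rabs_pos | exact Hq].
- replace eps with ((1 + Rabs (g' x)) * (eps / (1 + Rabs (g' x)))) by (field; lra).
  apply Rmult_lt_compat_l; lra.
Qed.

Lemma deriv_within_is_derive (g g' : R -> R) (x : R) : 0 < x ->
  deriv_within_nonneg g g' x -> is_derive g x (g' x).
Proof.
intros Hx H; apply is_derive_Reals; intros eps He.
destruct (H eps He) as [d [Hd Hh]].
assert (Hm : 0 < Rmin d x) by (apply Rmin_glb_lt; assumption).
exists (mkposreal _ Hm); intros h Hh0 Hhd; simpl in Hhd.
pose proof (Rmin_l d x); pose proof (Rmin_r d x).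
apply Hh; [exact Hh0 | apply Rabs_lt_between in Hhd; lra | lra].
Qed.

Lemma cont_within_bounded (g : R -> R) (b : R) : 0 <= b ->
  (forall x, 0 <= x -> cont_within_nonneg g x) ->
  exists B, 0 <= B /\ forall x, 0 <= x <= b -> Rabs (g x) <= B.
Proof.
intros Hb Hg.
(* Composition with [Rmax 0] extends the function to the left by its value at 0 and makes continuity
   at 0 two-sided. *)
assert (Hc : forall c, 0 <= c <= b -> continuity_pt (fun y => Rabs (g (Rmax 0 y))) c).
{ intros c Hc; apply (continuity_pt_comp (fun y => g (Rmax 0 y)) Rabs); [|apply Rcontinuity_abs].
  apply continuity_pt_filterlim, filterlim_locally; intros eps.
  rewrite (Rmax_right 0 c) by lra.
  destruct (Hg c (proj1 Hc) eps (cond_pos eps)) as [d [Hd Hy]].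
  exists (mkposreal d Hd); intros y Hyd.
  change (Rabs (y - c) < d) in Hyd. apply Hy; [apply Rmax_l|].
  eapply Rle_lt_trans; [|exact Hyd].
  unfold Rmax; destruct (Rle_dec 0 y); [lra|].
  rewrite !Rabs_left1 by lra; lra. }
destruct (continuity_ab_maj _ 0 b Hb Hc) as [M [HM _]].
exists (Rabs (g (Rmax 0 M))); split; [apply Rabs_pos | intros x Hx].
specialize (HM x Hx); rewrite (Rmax_right 0 x) in HM by lra; exact HM.
Qed.

(** With [Y >= 1], the function is bounded on [(0, Y]] by continuity up to 0, while
    [x^(-r) >= Y^(-beta)] there; beyond [Y] one has [x^(-beta) <= x^(-r)]. Hence one constant serves
    all [r]. *)
Lemma power_bounds (g : R -> R) (K X beta : R) : 0 <= beta -> 0 < X ->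
  (forall x, 0 <= x -> cont_within_nonneg g x) ->
  (forall x, X < x -> Rabs (g x) <= K * Rpower x (- beta)) ->
  exists C, forall x r, 0 < x -> 0 <= r <= beta -> Rabs (g x) <= C * Rpower x (- r).
Proof.
intros Hbeta HX Hc Hb.
set (Y := Rmax 1 X).
assert (HY1 : 1 <= Y) by apply Rmax_l. assert (HYX : X <= Y) by apply Rmax_r.
destruct (cont_within_bounded g Y ltac:(lra) Hc) as [B [HB HgB]].
exists (B * Rpower Y beta + Rabs K); intros x r Hx Hr.
rewrite Rmult_plus_distr_r.
pose proof (Rpower_pos x (- r)) as Hp.
destruct (Rle_lt_dec x Y) as [Hxy | Hxy].
- assert (H1 : 1 <= Rpower Y beta * Rpower x (- r)).
  { apply Rle_trans with (Rpower x r * Rpower x (- r)).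
    - rewrite <- Rpower_plus, Rplus_opp_r, Rpower_O by exact Hx; lra.
    - apply Rmult_le_compat_r; [lra|].
      apply Rle_trans with (Rpower Y r); [apply Rpower_le_base; lra | apply Rle_Rpower; lra]. }
  pose proof (HgB x ltac:(lra)). pose proof (Rabs_pos K). nra.
- assert (H1 : Rpower x (- beta) <= Rpower x (- r)) by (apply Rle_Rpower; lra).
  pose proof (Hb x ltac:(lra)). pose proof (Rpower_pos x (- beta)). pose proof (Rpower_pos Y beta).
  pose proof (Rle_abs K).
  assert (0 <= B * Rpower Y beta * Rpower x (- r)) by (apply Rmult_le_pos; [apply Rmult_le_pos|]; lra).
  assert (K * Rpower x (- beta) <= Rabs K * Rpower x (- r)).
  { apply Rle_trans with (Rabs K * Rpower x (- beta)); [apply Rmult_le_compat_r; lra|].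
    apply Rmult_le_compat_l; [apply Rabs_pos | exact H1]. }
  lra.
Qed.

Lemma regular_of_decay (alpha K X : R) (f f1 f2 : R -> R) : 1 < alpha -> 0 < X ->
  (forall x, 0 <= x -> deriv_within_nonneg f f1 x /\ deriv_within_nonneg f1 f2 x /\ cont_within_nonneg f2 x) ->
  (forall x, X < x -> Rabs (f x) <= K * Rpower x (- alpha) /\
     Rabs (f1 x) <= K * Rpower x (- alpha - 1) /\ Rabs (f2 x) <= K * Rpower x (- alpha - 2)) ->
  exists e C, 0 < e <= 1 / 8 /\ regular e C f f1 f2.
Proof.
intros Ha HX Hd Hb.
destruct (power_bounds f K X alpha) as [C0 H0]; [lra | exact HX | | apply Hb |].
{ intros x Hx; apply (deriv_within_cont_within f f1), Hd, Hx. }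
destruct (power_bounds f1 K X (alpha + 1)) as [C1 H1]; [lra | exact HX | | |].
{ intros x Hx; apply (deriv_within_cont_within f1 f2), Hd, Hx. }
{ intros x Hx; replace (- (alpha + 1)) with (- alpha - 1) by ring; apply Hb, Hx. }
destruct (power_bounds f2 K X (alpha + 2)) as [C2 H2]; [lra | exact HX | intros x Hx; apply Hd, Hx | |].
{ intros x Hx; replace (- (alpha + 2)) with (- alpha - 2) by ring; apply Hb, Hx. }
(* The first entry ensures [1 + 4 e <= alpha]; the cap keeps [1/2 - e] and [1/2 + e], used for the
   logarithmic moment, inside (0, 1). *)
set (e := Rmin ((alpha - 1) / 4) (1 / 8)).
assert (He : 0 < e <= 1 / 8) by (split; [apply Rmin_glb_lt; lra | apply Rmin_r]).
assert (Hea : e <= (alpha - 1) / 4) by apply Rmin_l.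
assert (Hmax : forall c x r, c <= Rmax C0 (Rmax C1 C2) ->
  c * Rpower x r <= Rmax C0 (Rmax C1 C2) * Rpower x r)
  by (intros; apply Rmult_le_compat_r; [left; apply Rpower_pos | assumption]).
exists e, (Rmax C0 (Rmax C1 C2)); split; [exact He | split; [|split]].
- intros x Hx; apply deriv_within_is_derive; [exact Hx | apply Hd; lra].
- intros x Hx; apply deriv_within_is_derive; [exact Hx | apply Hd; lra].
- intros x r Hx; split; [|split]; intros Hr; (eapply Rle_trans; [|apply Hmax]).
  + apply H0; lra.
  + apply Rmax_l.
  + apply H1; lra.
  + eapply Rle_trans; [apply Rmax_l | apply Rmax_r].
  + apply H2; lra.
  + eapply Rle_trans; [apply Rmax_r | apply Rmax_r].
Qed.

(** * Reduction to real and imaginary parts *)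

Lemma Rabs_le_Cnorm (z : Cplx) : Rabs (Cre z) <= Cnorm z /\ Rabs (Cim z) <= Cnorm z.
Proof.
unfold Cnorm; split; rewrite <- sqrt_Rsqr_abs; apply sqrt_le_1_alt; unfold Rsqr; nra.
Qed.

Theorem theorem2 (alpha : R) (f : R -> Cplx) (sigma t : R) :
  1 < alpha -> M_class alpha f -> 0 < sigma -> sigma < 1 ->
  let s := mkC sigma t in
  has_integral_0_inf_C
    (fun x => Cmul (Cpow x (Csub s (RtoC 1)))
       (Csub (series_C (fun n => Cmul (RtoC (INR (ndiv (S n)))) (f (INR (S n) * x))))
             (integral_0_inf_C (fun y => Cmul (f (x * y)) (RtoC (ln y + 2 * euler_gamma))))))
    (Cmul (Cmul (zeta s) (zeta s)) (mellin f s)).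
Proof.
intros Ha [f1 [f2 [Hf [Hf1 [Hf2 [K [X [HX Hb]]]]]]]] Hs0 Hs1 s.
assert (Hs : 0 < Cre s < 1) by (simpl; lra).
assert (Hre : exists e C, 0 < e <= 1 / 8 /\
  regular e C (fun x => Cre (f x)) (fun x => Cre (f1 x)) (fun x => Cre (f2 x))).
{ apply (regular_of_decay alpha K X); auto.
  - intros x Hx; split; [apply Hf, Hx | split; [apply Hf1, Hx | apply Hf2, Hx]].
  - intros x Hx; destruct (Hb x Hx) as [B0 [B1 B2]].
    split; [|split]; (eapply Rle_trans; [apply Rabs_le_Cnorm | assumption]). }
assert (Him : exists e C, 0 < e <= 1 / 8 /\
  regular e C (fun x => Cim (f x)) (fun x => Cim (f1 x)) (fun x => Cim (f2 x))).
{ apply (regular_of_decay alpha K X); auto.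
  - intros x Hx; split; [apply Hf, Hx | split; [apply Hf1, Hx | apply Hf2, Hx]].
  - intros x Hx; destruct (Hb x Hx) as [B0 [B1 B2]].
    split; [|split]; (eapply Rle_trans; [apply Rabs_le_Cnorm | assumption]). }
destruct Hre as [e [C [He HR]]]; destruct Him as [e' [C' [He' HI]]].
destruct (divisor_formula_real e C _ _ _ s He HR Hs) as [Sr [Jr [lr [HSr [HJr [Hlr Hr]]]]]].
destruct (divisor_formula_real e' C' _ _ _ s He' HI Hs) as [Si [Ji [li [HSi [HJi [Hli Hi]]]]]].
(* Both sides of the formula are linear in [f], so the real case for [Re f] plus [i] times the real
   case for [Im f] gives the complex one. *)
set (i := mkC 0 1).
assert (Hz : forall a b, (a, b) = Cadd (RtoC a) (Cmul i (RtoC b)))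
  by (intros a b; unfold i, Cadd, Cmul, RtoC, mkC; Cplx_ext; ring).
assert (Hmellin : mellin f s = Cadd lr (Cmul i li)).
{ apply ImproperC_integral.
  generalize (ImproperC_plus _ _ _ _ Hlr (ImproperC_mult i _ _ Hli)).
  apply ImproperC_ext; intros x Hx.
  assert (E : f x = Cadd (RtoC (Cre (f x))) (Cmul i (RtoC (Cim (f x)))))
    by (rewrite <- Hz; apply surjective_pairing).
  rewrite E at 3; ring. }
apply ImproperC_has_integral; rewrite Hmellin.
replace (Cmul (Cmul (zeta s) (zeta s)) (Cadd lr (Cmul i li)))
  with (Cadd (Cmul (zeta s) (Cmul (zeta s) lr)) (Cmul i (Cmul (zeta s) (Cmul (zeta s) li)))) by ring.
generalize (ImproperC_plus _ _ _ _ Hr (ImproperC_mult i _ _ Hi)).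
apply ImproperC_ext; intros x Hx.
(* The values picked by [epsilon] are identified by exhibiting a sum or an integral and appealing to
   uniqueness. *)
assert (Hseries : series_C (fun n => Cmul (RtoC (INR (ndiv (S n)))) (f (INR (S n) * x))) = (Sr x, Si x)).
{ assert (Hsum : has_sum_C (fun n => Cmul (RtoC (INR (ndiv (S n)))) (f (INR (S n) * x))) (Sr x, Si x)).
  { split; [generalize (HSr x Hx) | generalize (HSi x Hx)]; unfold infinite_sum; intros H eps Heps;
      destruct (H eps Heps) as [N HN]; exists N; intros n Hn; specialize (HN n Hn);
      erewrite sum_eq; [exact HN | | exact HN |]; intros k Hk;
      [apply Cre_real_mult | apply Cim_real_mult]. }
  apply (has_sum_C_unique _ _ _ (epsilon_spec _ _ (ex_intro _ _ Hsum)) Hsum). }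
assert (Hint : integral_0_inf_C (fun y => Cmul (f (x * y)) (RtoC (ln y + 2 * euler_gamma))) = (Jr x, Ji x)).
{ apply ImproperC_integral; split.
  - generalize (HJr x Hx); apply Improper_ext; intros y Hy; simpl; ring.
  - generalize (HJi x Hx); apply Improper_ext; intros y Hy; simpl; ring. }
rewrite Hseries, Hint, (Hz (Sr x) (Si x)), (Hz (Jr x) (Ji x)), !RtoC_minus; ring.
Qed.
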